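(* (1) Let $\lambda_*$ be a simple eigenvalue of a discrete Sturm-Liouville problem $(\boldsymbol{\omega},\mathbf{A})\in\Omega_N^{\mathbb{C}}\times\mathcal{A}^{\mathbb{C}}$. Then there is a continuous function $\Lambda:\mathcal{M}\to\mathbb{C}$ defined on a connected neighborhood $\mathcal{M}$ of $(\boldsymbol{\omega},\mathbf{A})$ in $\Omega_N^{\mathbb{C}}\times\mathcal{A}^{\mathbb{C}}$ such that (i) $\Lambda(\boldsymbol{\omega},\mathbf{A})=\lambda_*$; (ii) for any $(\boldsymbol{\sigma},\mathbf{B})\in\mathcal{M}$, $\Lambda(\boldsymbol{\sigma},\mathbf{B})$ is a simple eigenvalue of $(\boldsymbol{\sigma},\mathbf{B})$. (2) Let $\lambda_*$ be an eigenvalue of a self-adjoint discrete Sturm-Liouville problem $(\boldsymbol{\omega},\mathbf{A})\in\Omega_N^{\mathbb{R},+}\times\mathcal{B}^{\mathbb{C}}$ with multiplicity $2$. Fix a small $\epsilon>0$ such that $\lambda_*$ is the only eigenvalue of $(\boldsymbol{\omega},\mathbf{A})$ in the interval $[\lambda_*-\epsilon,\lambda_*+\epsilon]$. Then there are continuous functions $\Lambda_1,\Lambda_2:\mathcal{F}\to\mathbb{R}$ defined on a connected neighborhood $\mathcal{F}$ of $(\boldsymbol{\omega},\mathbf{A})$ in $\Omega_N^{\mathbb{R},+}\times\mathcal{B}^{\mathbb{C}}$ such that (i) $\Lambda_1(\boldsymbol{\omega},\mathbf{A})=\Lambda_2(\boldsymbol{\omega},\mathbf{A})=\lambda_*$;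 (ii) $\lambda_*-\epsilon<\Lambda_1(\boldsymbol{\sigma},\mathbf{B})\le\Lambda_2(\boldsymbol{\sigma},\mathbf{B})<\lambda_*+\epsilon$ for each $(\boldsymbol{\sigma},\mathbf{B})\in\mathcal{F}$; (iii) for every $(\boldsymbol{\sigma},\mathbf{B})\in\mathcal{F}$, $\Lambda_1(\boldsymbol{\sigma},\mathbf{B})$ and $\Lambda_2(\boldsymbol{\sigma},\mathbf{B})$ are eigenvalues of $(\boldsymbol{\sigma},\mathbf{B})$.
   Context: $N\ge2$ is an integer, $\Delta y_n=y_{n+1}-y_n$, $\nabla y_n=y_n-y_{n-1}$. A discrete Sturm-Liouville equation $-\nabla(f_n\Delta y_n)+q_ny_n=\lambda w_ny_n$, $1\le n\le N$, with complex coefficients, $f_n\ne0$ ($0\le n\le N$), $w_n\neq0$ ($1\le n\le N$), is identified with $\boldsymbol{\omega}=(1/f,q,w)=(1/f_0,\dots,1/f_N,q_1,\dots,q_N,w_1,\dots,w_N)$; $\Omega_N^{\mathbb{C}}\subset\mathbb{C}^{3N+1}$ is the (open) set of all such triples with the induced topology, and $\Omega_N^{\mathbb{R},+}$ is its subspace of real triples with $w_n>0$ for all $n$. A boundary condition is $A\begin{pmatrix}y_0\\ f_0\Delta y_0\end{pmatrix}+B\begin{pmatrix}y_N\\ f_N\Delta y_N\end{pmatrix}=0$ with $A,B$ complex $2\times2$ matrices, $\mathrm{rank}(A,B)=2$; it is denoted $\mathbf{A}=[A\,|\,B]$, where $(A,B)$ and $(TA,TB)$, $T\in GL(2,\mathbb{C})$,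 are identified. $\mathcal{A}^{\mathbb{C}}$ is the resulting quotient space with the quotient topology. $\mathcal{B}^{\mathbb{C}}\subset\mathcal{A}^{\mathbb{C}}$ is the subspace of self-adjoint boundary conditions, i.e. those with $AEA^*=BEB^*$, $E=\begin{pmatrix}0&1\\-1&0\end{pmatrix}$. A problem is self-adjoint if it lies in $\Omega_N^{\mathbb{R},+}\times\mathcal{B}^{\mathbb{C}}$. A complex number $\lambda$ is an eigenvalue of the problem if there is a nonzero sequence $y=\{y_n\}_{n=0}^{N+1}$ of complex numbers satisfying both the equation and the boundary condition. $\phi(\lambda),\psi(\lambda)$ are the solutions of the equation with $\phi_0=1$, $f_0\Delta\phi_0=0$, $\psi_0=0$, $f_0\Delta\psi_0=1$, and $\Phi_N(\lambda)=\begin{pmatrix}\phi_N(\lambda)&\psi_N(\lambda)\\ f_N\Delta\phi_N(\lambda)&f_N\Delta\psi_N(\lambda)\end{pmatrix}$. The (analytic) multiplicity of an eigenvalue is its order as a zero of the polynomial $\Gamma(\lambda)=\det(A+B\Phi_N(\lambda))$ (well defined up to a nonzero constant factor); an eigenvalue is simple if its multiplicity is $1$. *)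

(* Defs.v *)
From HB Require Import structures.
From mathcomp Require Import all_boot all_order all_algebra.
From mathcomp Require Import complex.
From mathcomp Require Import all_classical all_reals all_analysis.
From mathcomp Require Import ring.

Set Implicit Arguments.
Unset Strict Implicit.
Unset Printing Implicit Defensive.

Import Order.TTheory GRing.Theory Num.Theory.
Import numFieldNormedType.Exports.

Local Open Scope classical_set_scope.
Local Open Scope ring_scope.
Local Open Scope complex_scope.
Local Open Scope sesquilinear_scope.
Local Open Scope quotient_scope.

(* The library puts the norm topology on a [numFieldType] variable, but does
   not find it by itself on the concrete type [R[i]]. *)
HB.instance Definition _ (R : realType) := NormedModule.copy R[i] R[i]^o.

(* Entry number k (counted from 0) of a row vector, and 0 out of range. *)
Definition entry (C : nmodType) (m : nat) (v : 'rV[C]_m) (k : nat) : C :=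
  if insub k is Some i then v 0 i else 0.

Definition fdiff (C : zmodType) (y : nat -> C) (n : nat) : C := y n.+1 - y n.
Definition bdiff (C : zmodType) (y : nat -> C) (n : nat) : C := y n - y n.-1.

Section Equations.
Variables (R : realType) (N : nat).
Local Notation C := R[i].

(* (1/f, q, w); the second and third components list q_1, ..., q_N and
   w_1, ..., w_N, so that q_n sits at position n - 1. *)
Definition coeffs : Type := ('rV[C]_N.+1 * 'rV[C]_N * 'rV[C]_N)%type.

Definition coef_f (om : coeffs) (n : nat) : C := (entry om.1.1 n)^-1.
Definition coef_q (om : coeffs) (n : nat) : C := entry om.1.2 n.-1.
Definition coef_w (om : coeffs) (n : nat) : C := entry om.2 n.-1.

Definition OmegaC : set coeffs :=
  [set om : coeffs | (forall i, om.1.1 0 i != 0) /\ (forall i, om.2 0 i != 0)].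

(* In the order of [R[i]], [0 < z] says that z is real and positive. *)
Definition OmegaRpos : set coeffs :=
  [set om : coeffs | [/\ OmegaC om,
                forall i, om.1.1 0 i \is Num.real,
                forall i, om.1.2 0 i \is Num.real
              & forall i, 0 < om.2 0 i]].

(* Only the values y 0, ..., y N.+1 are involved. *)
Definition solves (om : coeffs) (lam : C) (y : nat -> C) : Prop :=
  forall n, (1 <= n <= N)%N ->
    - bdiff (fun m => coef_f om m * fdiff y m) n + coef_q om n * y n
    = lam * coef_w om n * y n.

Definition state (om : coeffs) (y : nat -> C) (n : nat) : 'cV[C]_2 :=
  \col_(i < 2) (if i == 0 then y n else coef_f om n * fdiff y n).

(* The pair (y_n, f_n (Delta y)_n), as polynomials in the spectral parameter,
   for the solution with y_0 = a and f_0 (Delta y)_0 = b. *)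
Fixpoint ivp (om : coeffs) (a b : C) (n : nat) : {poly C} * {poly C} :=
  if n is m.+1 then
    let y := (ivp om a b m).1 + (coef_f om m)^-1 *: (ivp om a b m).2 in
    (y, (ivp om a b m).2 + ((coef_q om n)%:P - coef_w om n *: 'X) * y)
  else (a%:P, b%:P).

Definition PhiN (om : coeffs) : 'M[{poly C}]_2 :=
  \matrix_(i < 2, j < 2)
    let s := if j == 0 then ivp om 1 0 N else ivp om 0 1 N in
    if i == 0 then s.1 else s.2.

End Equations.

Arguments OmegaC R N : clear implicits.
Arguments OmegaRpos R N : clear implicits.

Section BoundaryConditions.
Variable R : realType.
Local Notation C := R[i].

Definition bc_pair : set ('M[C]_2 * 'M[C]_2) :=
  [set AB | \rank (row_mx AB.1 AB.2) = 2%N].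

Definition bc_eq (AB AB' : bc_pair) : bool :=
  `[< exists2 T : 'M[C]_2, T \in unitmx &
        set_val AB' = (T *m (set_val AB).1, T *m (set_val AB).2) >].

Lemma bc_eq_refl : reflexive bc_eq.
Proof.
move=> AB; apply/asboolP; exists 1%:M; first exact: unitmx1.
by rewrite !mul1mx; case: (set_val AB).
Qed.

Lemma bc_eq_sym : symmetric bc_eq.
Proof.
suff H AB AB' : bc_eq AB AB' -> bc_eq AB' AB.
  by move=> AB AB'; apply/idP/idP; exact: H.
move=> /asboolP[T uT E]; apply/asboolP; exists (invmx T).
  by rewrite unitmx_inv.
by rewrite E /= !mulKmx//; case: (set_val AB).
Qed.

Lemma bc_eq_trans : transitive bc_eq.
Proof.
move=> AB AB' AB'' /asboolP[T uT E] /asboolP[S uS E']; apply/asboolP.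
exists (S *m T); first by rewrite unitmx_mul uS.
by rewrite E' E /= !mulmxA.
Qed.

Definition bc_equiv : equiv_rel bc_pair :=
  EquivRel bc_eq bc_eq_refl bc_eq_sym bc_eq_trans.

Definition bc_space : Type := quotient_topology {eq_quot bc_equiv}.
HB.instance Definition _ := Topological.on bc_space.
HB.instance Definition _ := Quotient.on bc_space.

(* Notions attached to a class [A | B] are computed on a representative; that
   the choice does not matter is proved below. *)
Definition bcA (bc : bc_space) : 'M[C]_2 := (set_val (repr bc)).1.
Definition bcB (bc : bc_space) : 'M[C]_2 := (set_val (repr bc)).2.

Definition Emx : 'M[C]_2 :=
  \matrix_(i < 2, j < 2)
    (if (i == 0) && (j == 1) then 1 else if (i == 1) && (j == 0) then -1 else 0).

Definition sa_pair (A B : 'M[C]_2) : Prop := A *m Emx *m A^t* = B *m Emx *m B^t*.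

Definition BC : set bc_space := [set bc | sa_pair (bcA bc) (bcB bc)].

End BoundaryConditions.

Arguments bc_pair R : clear implicits.
Arguments BC R : clear implicits.

Section Spectrum.
Variables (R : realType) (N : nat).
Local Notation C := R[i].
Implicit Types (om : coeffs R N) (A B : 'M[C]_2) (bc : bc_space R).

Definition eigenvalue_pair om A B (lam : C) : Prop :=
  exists y : nat -> C,
    [/\ exists2 n, (n <= N.+1)%N & y n != 0,
        solves om lam y
      & A *m state om y 0 + B *m state om y N = 0].

Definition is_eigenvalue om bc (lam : C) : Prop :=
  eigenvalue_pair om (bcA bc) (bcB bc) lam.

Definition Gamma_pair om A B : {poly C} :=
  \det (map_mx polyC A + map_mx polyC B *m PhiN om).

Definition multiplicity om bc (lam : C) : nat :=
  mup lam (Gamma_pair om (bcA bc) (bcB bc)).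

Definition simple_eigenvalue om bc (lam : C) : Prop :=
  is_eigenvalue om bc lam /\ multiplicity om bc lam = 1%N.

End Spectrum.

Section Checks.
Variables (R : realType) (N : nat).
Local Notation C := R[i].
Implicit Types (om : coeffs R N) (A B T : 'M[C]_2).

Lemma bc_reprP (AB : bc_pair R) : exists2 T : 'M[C]_2, T \in unitmx &
  bcA (\pi AB) = T *m (set_val AB).1 /\ bcB (\pi AB) = T *m (set_val AB).2.
Proof.
have /eqmodP/asboolP[T uT E] : AB = repr (\pi_(bc_space R) AB) %[mod bc_space R].
  by rewrite reprK.
by exists T => //; rewrite /bcA /bcB E.
Qed.

Lemma sa_pair_mul A B T : T \in unitmx ->
  sa_pair (T *m A) (T *m B) <-> sa_pair A B.
Proof.
move=> uT; have uT' : T^t* \in unitmx by rewrite map_unitmx unitmx_tr.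
rewrite /sa_pair !trmx_mul !map_mxM.
have mulE M : T *m M *m @Emx R *m (M^t* *m T^t*) =
    T *m (M *m @Emx R *m M^t*) *m T^t* by rewrite !mulmxA.
rewrite !mulE; split=> [|-> //].
by move=> /(can_inj (mulmxK uT'))/(can_inj (mulKmx uT)).
Qed.

Lemma eigenvalue_pair_mul om A B T lam : T \in unitmx ->
  eigenvalue_pair om (T *m A) (T *m B) lam <-> eigenvalue_pair om A B lam.
Proof.
move=> uT; split=> -[y [y0 sy by0]]; exists y; split=> //.
  by move: by0; rewrite -!mulmxA -mulmxDr => /(canRL (mulKmx uT)); rewrite mulmx0.
by rewrite -!mulmxA -mulmxDr by0 mulmx0.
Qed.

Lemma Gamma_pair_mul om A B T :
  Gamma_pair om (T *m A) (T *m B) = \det T *: Gamma_pair om A B.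
Proof.
by rewrite /Gamma_pair !map_mxM -mulmxA -mulmxDr det_mulmx det_map_mx mul_polyC.
Qed.

Lemma BC_pi (AB : bc_pair R) :
  BC R (\pi AB) <-> sa_pair (set_val AB).1 (set_val AB).2.
Proof.
by have [T uT [EA EB]] := bc_reprP AB; rewrite /BC /= EA EB sa_pair_mul.
Qed.

Lemma is_eigenvalue_pi om (AB : bc_pair R) lam :
  is_eigenvalue om (\pi AB) lam <->
  eigenvalue_pair om (set_val AB).1 (set_val AB).2 lam.
Proof.
have [T uT [EA EB]] := bc_reprP AB.
by rewrite /is_eigenvalue EA EB eigenvalue_pair_mul.
Qed.

Lemma multiplicity_pi om (AB : bc_pair R) lam :
  multiplicity om (\pi AB) lam =
  mup lam (Gamma_pair om (set_val AB).1 (set_val AB).2).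
Proof.
have [T uT [EA EB]] := bc_reprP AB.
rewrite /multiplicity EA EB Gamma_pair_mul -mul_polyC mupMr// rootC.
by move: uT; rewrite unitmxE unitfE.
Qed.

Lemma coef_f_neq0 om n : OmegaC R N om -> (n <= N)%N -> coef_f om n != 0.
Proof.
by move=> [f0 _] nN; rewrite invr_eq0 /entry insubT.
Qed.

Lemma ivp_solves om lam a b : OmegaC R N om ->
  let y n := (ivp om a b n).1.[lam] in
  [/\ solves om lam y, y 0%N = a &
      forall n, (n <= N)%N -> coef_f om n * fdiff y n = (ivp om a b n).2.[lam]].
Proof.
move=> Om y; have yz n : (n <= N)%N ->
    coef_f om n * fdiff y n = (ivp om a b n).2.[lam].
  move=> nN; rewrite /fdiff /y /= !hornerE addrAC subrr add0r mulVKf//.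
  exact: coef_f_neq0.
split=> //; last by rewrite /y /= hornerC.
case=> // n nN; rewrite /bdiff yz// yz ?(ltnW nN)// /y /= !hornerE.
by ring.
Qed.

Lemma solves_ivp om lam y : OmegaC R N om -> solves om lam y ->
  let s := ivp om (y 0%N) (coef_f om 0 * fdiff y 0) in
  (forall n, (n <= N.+1)%N -> y n = (s n).1.[lam]) /\
  (forall n, (n <= N)%N -> coef_f om n * fdiff y n = (s n).2.[lam]).
Proof.
move=> Om sy s.
have next n : (n <= N)%N -> y n = (s n).1.[lam] ->
    coef_f om n * fdiff y n = (s n).2.[lam] -> y n.+1 = (s n.+1).1.[lam].
  move=> nN yn zn; rewrite /s /= -/s !hornerE -yn -zn mulKf ?coef_f_neq0//.
  by rewrite /fdiff addrC subrK.
have IH n : (n <= N)%N ->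
    y n = (s n).1.[lam] /\ coef_f om n * fdiff y n = (s n).2.[lam].
  elim: n => [_|n IHn nN]; first by rewrite /s /= !hornerC.
  have [yn zn] := IHn (ltnW nN); have yS := next _ (ltnW nN) yn zn.
  have zS : (s n.+1).2.[lam] = (s n).2.[lam] +
      (coef_q om n.+1 - coef_w om n.+1 * lam) * (s n.+1).1.[lam].
    by rewrite /s /= !hornerE.
  split=> //; rewrite zS -yS -zn; have := sy n.+1 nN; rewrite /bdiff /=.
  move: (coef_f om n.+1 * _) (coef_f om n * _) => F z E.
  have -> : F = z + coef_q om n.+1 * y n.+1 -
    (- (F - z) + coef_q om n.+1 * y n.+1) by ring.
  by rewrite E; ring.
split=> [n|n /IH[]//]; case: n => [_|n nN]; first by have [] := IH 0%N.
by have [yn zn] := IH _ nN; exact: next.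
Qed.

End Checks.

(* Main.v *)
Require Import Defs.
From mathcomp Require Import all_boot all_order all_algebra.
From mathcomp Require Import complex.
From mathcomp Require Import all_classical all_reals all_analysis.
From mathcomp Require Import ring lra.

(** The eigenvalues of a problem are the roots of the polynomial Gamma, and
    replacing (A, B) by (TA, TB) multiplies Gamma by det T. Near a fixed class
    [A0 | B0] every class has a unique representative (A, B) with
    A A0* + B B0* = A0 A0* + B0 B0* (stars are adjoints), and that
    representative is continuous in the class ([normal_rep_cvg_pair]). So,
    up to a nonzero scalar, Gamma has coefficients that are continuous in the
    problem ([Gamma_loc_poly_cvg]), and the statement reduces to the continuity
    of the roots of a polynomial whose degree is bounded but may jump.

    Continuity of roots rests on one estimate, [norm_horner_far_roots]: if all
    roots of p are at distance at least d from l, then |p| grows by at most the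
    factor 2^n from l to any point of the disk of radius d, where n bounds the
    degree. Hence, if l is a root of the limit polynomial, nearby polynomials
    must have a root near l ([root_near]). Dividing by the linear factor gives again a convergent
    family ([poly_cvg_factor]), so a root of multiplicity m splits off m roots
    that converge to l, and the remaining cofactor has no root in a fixed disk
    ([nonroot_disk]). For m = 1 the root in the disk is unique, and it is the
    continuous function of part (1). For m = 2 and a self-adjoint problem both
    roots in the disk are real, because the eigenvalues of a self-adjoint
    problem are ([selfadjoint_eigenvalue_real], by Lagrange's identity), and
    the smaller and the larger one are the two functions of part (2).

    There remains to find connected neighborhoods inside a given neighborhood.
    Coefficients are joined to the center by segments. So are boundary
    conditions, through the normal forms above. The normal form W0 + V of a
    class near that of W0 = (A0, B0) satisfies V W0* = 0, and if W0 is
    isotropic for the form defining self-adjointness, then every row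
    orthogonal to the row space of W0 lies in another isotropic space
    ([ortho_isotropic]). The quadratic term in V vanishes therefore, and
    self-adjointness of W0 + V is a condition that is real linear in V: the
    whole segment W0 + tV is self-adjoint ([sa_segp]). *)

Set Implicit Arguments.
Unset Strict Implicit.
Unset Printing Implicit Defensive.

Import Order.TTheory GRing.Theory Num.Theory.
Import numFieldNormedType.Exports.

Local Open Scope classical_set_scope.
Local Open Scope ring_scope.
Local Open Scope complex_scope.

(** * Convergent families of polynomials *)

Section PolyCvg.
Variable R : realType.
Local Notation C := R[i].

Lemma cvg_sumC (T : Type) (F : set_system T) (FF : Filter F) (I : Type) (r : seq I)
    (f : I -> T -> C) (l : I -> C) : (forall i, f i @ F --> l i) ->
  (fun t => \sum_(i <- r) f i t) @ F --> \sum_(i <- r) l i.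
Proof. by move=> fl; apply: cvg_big => [|i _]; [exact: add_continuous|exact: fl]. Qed.

(** Coefficientwise convergence with a common bound on the degrees, without
    which the values at a point need not converge. The degree itself may drop
    in the limit, as that of Gamma does when B degenerates. *)
Definition poly_cvg (T : Type) (F : set_system T) (G : T -> {poly C}) (p : {poly C}) :=
  (exists n, (forall t, (size (G t) <= n)%N) /\ (size p <= n)%N) /\
  forall i, (fun t => (G t)`_i) @ F --> p`_i.

Context {T : Type} {F : set_system T} {FF : Filter F}.
Implicit Types (G H : T -> {poly C}) (p q : {poly C}).

Lemma poly_cvgC (c : T -> C) (c0 : C) : c @ F --> c0 -> poly_cvg F (fun t => (c t)%:P) c0%:P.
Proof.
move=> cc; split; first by exists 1%N; split => *; exact: size_polyC_leq1.
case=> [|i]; first by rewrite coefC /=; under eq_fun do rewrite coefC /=.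
by rewrite coefC /=; under eq_fun do rewrite coefC /=; exact: cvg_cst.
Qed.

Lemma poly_cvg_cst p : poly_cvg F (fun=> p) p.
Proof. by split=> [|i]; [exists (size p) | exact: cvg_cst]. Qed.

Lemma poly_cvgD G H p q : poly_cvg F G p -> poly_cvg F H q ->
  poly_cvg F (fun t => G t + H t) (p + q).
Proof.
move=> [[n [Gn pn]] Gc] [[m [Hm qm]] Hc]; split.
  exists (maxn n m); split=> [t|]; rewrite (leq_trans (size_polyD _ _))// geq_max;
    by rewrite !leq_max ?Gn ?Hm ?pn ?qm ?orbT.
by move=> i; rewrite coefD; under eq_fun do rewrite coefD; exact: cvgD.
Qed.

Lemma poly_cvgM G H p q : poly_cvg F G p -> poly_cvg F H q ->
  poly_cvg F (fun t => G t * H t) (p * q).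
Proof.
move=> [[n [Gn pn]] Gc] [[m [Hm qm]] Hc]; split.
  exists (n + m)%N; split=> [t|]; rewrite (leq_trans (size_polyMleq _ _))//;
    by rewrite (leq_trans (leq_pred _))// leq_add.
move=> i; rewrite coefM; under eq_fun do rewrite coefM.
apply: (@cvg_sumC _ F FF _ _ (fun (j : 'I_i.+1) t => (G t)`_j * (H t)`_(i - j))
  (fun j : 'I_i.+1 => p`_j * q`_(i - j))) => j.
exact: cvgM.
Qed.

Lemma cvg_expn (z : T -> C) (z0 : C) n :
  z @ F --> z0 -> (fun t => z t ^+ n) @ F --> z0 ^+ n.
Proof.
move=> zc; elim: n => [|n IH].
  by rewrite expr0; under eq_fun do rewrite expr0; exact: cvg_cst.
by rewrite exprS; under eq_fun do rewrite exprS; exact: (cvgM zc IH).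
Qed.

Lemma poly_cvg_horner G p (z : T -> C) (z0 : C) : poly_cvg F G p -> z @ F --> z0 ->
  (fun t => (G t).[z t]) @ F --> p.[z0].
Proof.
move=> [[n [Gn pn]] Gc] zc; rewrite (horner_coef_wide _ pn).
under eq_fun do rewrite (horner_coef_wide _ (Gn _)).
apply: (@cvg_sumC _ F FF _ _ (fun (i : 'I_n) t => (G t)`_i * z t ^+ i)
  (fun i : 'I_n => p`_i * z0 ^+ i)) => i.
by apply: (cvgM (Gc i)); exact: cvg_expn.
Qed.

Lemma poly_cvg_eq G H p : (forall t, G t = H t) -> poly_cvg F G p -> poly_cvg F H p.
Proof. by move=> /funext ->. Qed.

End PolyCvg.

(** * Continuity of the roots *)

Section Roots.
Variable R : realType.
Local Notation C := R[i].

(** On the disk of radius d around l, each factor z - r of p is at most twice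
    as large as l - r, since |z - l| <= d <= |l - r|. *)
Lemma norm_horner_far_roots (p : {poly C}) n (l d z : C) : (size p <= n)%N ->
  (forall r, root p r -> d <= `|r - l|) -> `|z - l| <= d ->
  `|p.[z]| <= 2 ^+ n * `|p.[l]|.
Proof.
move=> pn far zd; have [->|p0] := eqVneq p 0.
  by rewrite !horner0 normr0 mulr0.
have [rs Ep] := closed_field_poly_normal p.
have lc0 : lead_coef p != 0 by rewrite lead_coef_eq0.
have rsn : (size rs <= n)%N.
  apply: leq_trans pn; rewrite Ep size_scale//.
  by rewrite size_prod_XsubC.
have normE x : `|p.[x]| = `|lead_coef p| * \prod_(r <- rs) `|x - r|.
  rewrite {1}Ep hornerZ normrM horner_prod normr_prod; congr (_ * _).
  by apply: eq_bigr => r _; rewrite hornerXsubC.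
have rsP r : r \in rs -> d <= `|r - l|.
  by move=> rr; apply: far; rewrite Ep rootZ// root_prod_XsubC.
rewrite !normE mulrCA ler_wpM2l//.
apply: (@le_trans _ _ (2 ^+ size rs * \prod_(r <- rs) `|l - r|)); last first.
  by rewrite ler_wpM2r ?prodr_ge0// ler_eXn2l// ltr1n.
have -> : 2 ^+ size rs * \prod_(r <- rs) `|l - r| = \prod_(r <- rs) (2 * `|l - r|).
  by rewrite big_split /= big_const_seq count_predT iter_mulr mulr1.
rewrite big_seq [leRHS]big_seq; apply: ler_prod => r /rsP dr.
rewrite normr_ge0 /=.
have -> : z - r = (z - l) + (l - r) by ring.
rewrite (le_trans (ler_normD _ _))// [2 * _](_ : _ = `|l - r| + `|l - r|); last by ring.
by rewrite lerD2r (le_trans zd)// distrC.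
Qed.

(** Among the points l + e / (k + 2) only finitely many can be roots. *)
Lemma nonroot_near (p : {poly C}) (l e : C) : p != 0 -> 0 < e ->
  exists2 z : C, `|z - l| < e & p.[z] != 0.
Proof.
move=> p0 e0; apply: contrapT => H.
pose x k : C := l + e / k.+2%:R.
have xroot k : root p (x k).
  rewrite -[root _ _]negbK; apply/negP => nr; apply: H; exists (x k) => //.
  rewrite /x addrAC subrr add0r ger0_norm ?divr_ge0 ?ltW// ltr_pdivrMr ?ltr0n//.
  by rewrite ltr_pMr// ltr1n.
have := @max_poly_roots _ p [seq x k | k <- iota 0 (size p)] p0.
rewrite size_map size_iota ltnn; case/(_ _ _)/negP => //.
  by apply/allP => _ /mapP[k _ ->].
rewrite map_inj_uniq ?iota_uniq// => i j /addrI /(mulfI (lt0r_neq0 e0)) /invr_inj/eqP.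
by rewrite eqr_nat => /eqP[].
Qed.

Context {T : Type} {F : set_system T} {FF : Filter F}.
Implicit Types (G H : T -> {poly C}) (p q : {poly C}).

Lemma poly_cvg_at z G p : poly_cvg F G p ->
  (fun t => (G t).[z] : C) @ F --> (p.[z] : C).
Proof. by move=> Gp; apply: poly_cvg_horner => //; exact: cvg_cst. Qed.

(** Otherwise [norm_horner_far_roots] would bound the values G t at a fixed
    point z near l by a multiple of the values at l. The latter tend to
    p(l) = 0, and z can be chosen with p(z) != 0. *)
Lemma root_near G p (l e : C) : poly_cvg F G p -> p != 0 -> root p l -> 0 < e ->
  \forall t \near F, exists2 z : C, root (G t) z & `|z - l| < e.
Proof.
move=> Gp p0 pl e0; have [[n [Gn _]] _] := Gp.
have [z ze pz] := nonroot_near l p0 e0.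
have pz0 : 0 < `|p.[z]| by rewrite normr_gt0.
have Gz := @poly_cvg_at z _ _ Gp.
have Gl := @poly_cvg_at l _ _ Gp.
have d1 : 0 < `|p.[z]| / 2 by rewrite divr_gt0.
have d2 : 0 < `|p.[z]| / 2 / 2 ^+ n by rewrite divr_gt0// exprn_gt0.
have N1 := cvgr_dist_lt (FF := FF) _ _ Gz _ d1.
have N2 := cvgr_dist_lt (FF := FF) _ _ Gl _ d2.
apply: filterS2 N1 N2 => t h2 h1; apply: contrapT => H.
have far r : root (G t) r -> e <= `|r - l|.
  move=> rr; rewrite real_leNgt ?ger0_real ?(ltW e0)//.
  by apply/negP => re; apply: H; exists r.
have h3 := norm_horner_far_roots (Gn t) far (ltW ze).
rewrite (eqP pl) sub0r normrN ltr_pdivlMr ?exprn_gt0// mulrC in h1.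
have := ler_normD (p.[z] - (G t).[z]) (G t).[z]; rewrite subrK.
move=> h4; have := le_lt_trans h4 (ltrD h2 (le_lt_trans h3 h1)).
by rewrite -splitr ltxx.
Qed.

(** Evaluation is continuous jointly in the polynomial and in the point. *)
Lemma nonroot_disk H q (l : C) : poly_cvg F H q -> ~~ root q l ->
  exists2 d : C, 0 < d &
    \forall t \near F, forall z, `|z - l| < d -> ~~ root (H t) z.
Proof.
move=> Hq ql.
have c : (fun tz : T * C => (H tz.1).[tz.2]) @ filter_prod F (nbhs l) --> q.[l].
  apply: poly_cvg_horner; last exact: cvg_snd.
  have [[n [Hn qn]] Hc] := Hq; split; first by exists n.
  by move=> i; apply: (cvg_comp _ _ cvg_fst (Hc i)).
have q0 : 0 < `|q.[l]| by rewrite normr_gt0.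
have [[A B] /= [FA /nbhs_ballP[d d0 dB]] AB] :=
  cvgr_dist_lt (FF := filter_prod_filter FF (nbhs_filter l)) _ _ c _ q0.
exists d => //; apply: filterS FA => t At z zl.
have /= := AB (t, z); rewrite /root => /(_ _)/wrap[].
  by split => //; apply: dB; rewrite -ball_normE /= distrC.
by apply: contraTneq => ->; rewrite subr0 ltxx.
Qed.

Lemma seq_closest (l : C) (s : seq C) : s != [::] ->
  exists2 z, z \in s & forall y, y \in s -> `|z - l| <= `|y - l|.
Proof.
elim: s => // x s IH _; case: (eqVneq s [::]) => [->|/IH[z zs zmin]].
  by exists x; rewrite ?mem_head// => y; rewrite inE => /eqP ->.
have [h|h] := real_leP (normr_real (z - l)) (normr_real (x - l)).
  exists z; rewrite ?inE ?zs ?orbT// => y /predU1P[->//|]; exact: zmin.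
exists x; rewrite ?mem_head// => y /predU1P[->//|/zmin]; exact/le_trans/ltW.
Qed.

Lemma closest_root p (l : C) : p != 0 -> (exists r, root p r) ->
  exists z, root p z /\ forall y, root p y -> `|z - l| <= `|y - l|.
Proof.
move=> p0 [r pr]; have [rs Ep] := closed_field_poly_normal p.
have lc0 : lead_coef p != 0 by rewrite lead_coef_eq0.
have rE y : root p y = (y \in rs) by rewrite Ep rootZ// root_prod_XsubC.
have rs0 : rs != [::] by apply: contraTneq pr => rs0; rewrite rE rs0.
have [z zr zmin] := seq_closest l rs0.
by exists z; rewrite rE; split=> // y; rewrite rE; exact: zmin.
Qed.

(** The root r t closest to l tends to l by [root_near]. The coefficients of
    the quotient obey H_i = G_(i+1) + r H_(i+1), so their convergence
    propagates downwards from the vanishing coefficients of high index. *)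
Lemma poly_cvg_factor G p (l : C) : poly_cvg F G p -> p != 0 -> root p l ->
  exists (r : T -> C) H q,
    [/\ r @ F --> l, poly_cvg F H q, p = ('X - l%:P) * q
      & \forall t \near F, G t = ('X - (r t)%:P) * H t].
Proof.
move=> Gp p0 pl; have [[n [Gn pn]] Gc] := Gp.
have [q Eq] : exists q, p = ('X - l%:P) * q.
  by have /factor_theorem[q ->] := pl; exists q; rewrite mulrC.
pose r t := xget 0 [set z | root (G t) z /\
  forall y, root (G t) y -> `|z - l| <= `|y - l|].
have rP t : G t != 0 -> (exists r, root (G t) r) ->
    root (G t) (r t) /\ forall y, root (G t) y -> `|r t - l| <= `|y - l|.
  by move=> Gt0 Gr; exact: xgetPex (closest_root l Gt0 Gr).
have Gn0 : \forall t \near F, G t != 0.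
  have [z _ pz] := nonroot_near l p0 ltr01.
  have pz0 : 0 < `|p.[z]| by rewrite normr_gt0.
  have := cvgr_dist_lt (FF := FF) _ _ (@poly_cvg_at z _ _ Gp) _ pz0.
  apply: filterS => t; apply: contraTneq => ->.
  by rewrite horner0 subr0 ltxx.
have rl : r @ F --> l.
  apply/cvgrPdist_lt => e e0; have N1 := root_near Gp p0 pl e0.
  apply: filterS2 N1 Gn0 => t [z rz zl] Gt.
  have [_ /(_ _ rz)] := rP t Gt (ex_intro _ z rz).
  by rewrite distrC => /le_lt_trans; exact.
pose H t := if root (G t) (r t) then G t %/ ('X - (r t)%:P) else 0.
have HE : \forall t \near F, G t = ('X - (r t)%:P) * H t.
  have N1 := root_near Gp p0 pl ltr01.
  apply: filterS2 N1 Gn0 => t [z rz _] Gt.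
  have [rr _] := rP t Gt (ex_intro _ z rz).
  by rewrite /H rr mulrC divpK// dvdp_XsubCl.
have sH t : (size (H t) <= n)%N.
  rewrite /H; case: ifP => _; last by rewrite size_poly0.
  by rewrite size_divp ?polyXsubC_eq0// (leq_trans (leq_subr _ _)).
have sq : (size q <= n)%N.
  apply: leq_trans pn; apply: dvdp_leq => //.
  by rewrite Eq dvdp_mulIr.
exists r, H, q; split; [exact: rl| |exact: Eq|exact: HE].
split; first by exists n.
have coefXM (s : {poly C}) (c : C) i : s`_i = ((('X - c%:P) * s)`_i.+1 + c * s`_i.+1).
  by rewrite mulrBl coefB coefXM coefCM /= subrK.
suff Hc k : forall i, (n <= i + k)%N -> (fun t => (H t)`_i) @ F --> q`_i.
  by move=> i; apply: (Hc n); rewrite leq_addl.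
elim: k => [|k IH] i ik.
  rewrite addn0 in ik; have -> : q`_i = 0 by apply: nth_default; exact: leq_trans ik.
  have -> : (fun t => (H t)`_i) = (fun=> 0); last exact: cvg_cst.
  by apply/funext => t; apply: nth_default; exact: leq_trans ik.
rewrite (coefXM q l) -Eq.
have IHi := IH i.+1; rewrite addSnnS in IHi.
apply: cvg_trans (cvgD (Gc i.+1) (cvgM rl (IHi ik))).
apply: near_eq_cvg; apply: filterS HE => t GE.
by rewrite (coefXM (H t) (r t)) -GE.
Qed.

End Roots.

(** * Continuation of simple and of double roots *)

Section Continuation.
Variable R : realType.
Local Notation C := R[i].

(** Gamma is computed on an arbitrarily chosen representative of a boundary
    condition and is not continuous itself. Only its associates matter for
    roots and multiplicities, and one of them is continuous at t0. *)
Definition loc_poly_cvg (T : topologicalType) (G : T -> {poly C}) (t0 : T) :=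
  exists H, poly_cvg (nbhs t0) H (H t0) /\ \forall t \near t0, G t %= H t.

Lemma eqp_neq0 (p q : {poly C}) : p %= q -> p != 0 -> q != 0.
Proof. by move=> pq; apply: contraNneq => q0; rewrite -eqp0 -q0. Qed.

Lemma eqp_mup (p q : {poly C}) x : p %= q -> mup x p = mup x q.
Proof.
move=> pq; have [q0|q0] := eqVneq q 0.
  by move: pq; rewrite q0 eqp0 => /eqP ->.
have p0 : p != 0 by apply: eqp_neq0 q0; rewrite eqp_sym.
apply/eqP; rewrite eqn_leq; apply/andP; split.
  by rewrite mup_geq// -(eqp_dvdr _ pq) -mup_geq.
by rewrite mup_geq// (eqp_dvdr _ pq) -mup_geq.
Qed.

Lemma mup0 x : mup x (0 : {poly C}) = 0%N.
Proof. by rewrite /mup; case: arg_maxnP => //= -[[|[]]]; rewrite ?size_poly0. Qed.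

Lemma mup_gt0_neq0 (p : {poly C}) x : (0 < mup x p)%N -> p != 0.
Proof. by apply: contraTneq => ->; rewrite mup0. Qed.

Lemma mup_factor (p : {poly C}) x : p != 0 ->
  exists2 q, p = ('X - x%:P) ^+ mup x p * q & ~~ root q x.
Proof.
move=> p0; have : ('X - x%:P) ^+ mup x p %| p by rewrite -mup_geq.
move=> /dvdpP[q Eq]; exists q; first by rewrite mulrC.
apply/negP; rewrite -dvdp_XsubCl => xq.
have : ('X - x%:P) ^+ (mup x p).+1 %| p by rewrite {2}Eq exprS dvdp_mul.
by rewrite -mup_geq// ltnn.
Qed.

Lemma mup_root (p : {poly C}) x : (0 < mup x p)%N -> root p x.
Proof.
by move=> mp; rewrite -dvdp_XsubCl XsubC_dvd// (mup_gt0_neq0 mp).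
Qed.

Lemma mup_simple (q : {poly C}) x : ~~ root q x -> mup x (('X - x%:P) * q) = 1%N.
Proof. by move=> qx; rewrite mupMl// (mup_XsubCX 1) eqxx. Qed.

Section Simple.
Variables (T : topologicalType) (G : T -> {poly C}).
Hypothesis G_loc : forall t, loc_poly_cvg G t.

Lemma loc_root_near t (l e : C) : G t != 0 -> root (G t) l -> 0 < e ->
  \forall s \near t, exists2 z : C, root (G s) z & `|z - l| < e.
Proof.
move=> G0 Gl e0; have [H [Hc GH]] := G_loc t; have GHt := nbhs_singleton GH.
have H0 : H t != 0 by exact: eqp_neq0 GHt _.
have Hl : root (H t) l by rewrite -(eqp_root GHt).
have N1 := @root_near _ _ _ (nbhs_filter t) _ _ _ _ Hc H0 Hl e0.
by apply: filterS2 GH N1 => s GHs [z Hz zl]; exists z => //; rewrite (eqp_root GHs).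
Qed.

Definition isolated_simple (l d : C) (p : {poly C}) (z : C) :=
  [/\ `|z - l| < d, mup z p = 1%N & forall y, `|y - l| < d -> root p y -> y = z].

(** Splitting off the root near l leaves a cofactor without roots in a disk, so
    the only root in the disk is the one split off, and it is simple. *)
Lemma isolated_simple_near t (l : C) : mup l (G t) = 1%N ->
  exists2 d, 0 < d & \forall s \near t, exists z, isolated_simple l d (G s) z.
Proof.
move=> m1; have G0 : G t != 0 by rewrite (mup_gt0_neq0 (x := l))// m1.
have [q Eq ql] := mup_factor l G0; rewrite m1 expr1 in Eq.
have [H [Hc GH]] := G_loc t; have GHt := nbhs_singleton GH.
have H0 : H t != 0 by exact: eqp_neq0 GHt _.
have Hl : root (H t) l by rewrite -(eqp_root GHt) Eq rootM root_XsubC eqxx.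
have [r [K [q' [rl Kq EH HE]]]] := poly_cvg_factor (FF := nbhs_filter t) Hc H0 Hl.
have ql' : ~~ root q' l.
  have : ('X - l%:P) * q %= ('X - l%:P) * q' by rewrite -Eq -EH.
  by rewrite eqp_mul2l ?polyXsubC_eq0// => /eqp_root <-.
have [d d0 Kd] := nonroot_disk (FF := nbhs_filter t) Kq ql'.
exists d => //.
have rd := cvgr_dist_lt (FF := nbhs_filter t) _ _ rl _ d0.
apply: filterS2 (filterI GH HE) (filterI rd Kd) => s [GHs HEs] [rds Kds].
rewrite distrC in rds; exists (r s); split=> //.
  by rewrite (eqp_mup _ GHs) HEs mup_simple// Kds.
move=> y yd; rewrite (eqp_root GHs) HEs rootM root_XsubC.
by rewrite (negbTE (Kds _ yd)) orbF => /eqP.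
Qed.

(** At any t in Q some root of G s tends to L t as s tends to t. It ends up in
    the disk where L s is the only root, so it is L s. *)
Lemma simple_root_continuation t0 (l : C) : mup l (G t0) = 1%N ->
  exists (Q : set T) (L : T -> C),
    [/\ nbhs t0 Q, L t0 = l, {within Q, continuous L}
      & forall t, Q t -> mup (L t) (G t) = 1%N].
Proof.
move=> m1; have [d d0 near_d] := isolated_simple_near m1.
pose L t := xget 0 [set z | isolated_simple l d (G t) z].
pose Q := [set t | exists z, isolated_simple l d (G t) z].
have LP t : Q t -> isolated_simple l d (G t) (L t).
  by move=> Qt; exact: xgetPex.
exists Q, L; split.
- exact: near_d.
- have [_ _ Luniq] := LP _ (nbhs_singleton near_d).
  by rewrite -(Luniq l) ?subrr ?normr0// mup_root// m1.
- apply/subspace_continuousP => t Qt; apply/cvgrPdist_lt => e e0.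
  have [Ld Lm _] := LP t Qt.
  have G0 : G t != 0 by rewrite (mup_gt0_neq0 (x := L t))// Lm.
  have Lr : root (G t) (L t) by rewrite mup_root// Lm.
  have d1 : 0 < d - `|L t - l| by rewrite subr_gt0.
  (* A root closer than d - |L t - l| to L t stays in the disk around l. *)
  have [e1 e10 [e1e e1d]] : exists2 e1 : C, 0 < e1 & e1 <= e /\ e1 <= d - `|L t - l|.
    have [h|h] := real_leP (gtr0_real e0) (gtr0_real d1).
      by exists e.
    by exists (d - `|L t - l|) => //; split => //; exact: ltW.
  have near_e1 := loc_root_near G0 Lr e10.
  rewrite /within /=; apply: filterS near_e1 => s [z Hz zL] Qs.
  have [_ _ Luniq] := LP s Qs.
  change (`|L t - L s| < e); rewrite -(Luniq z _ Hz); first by rewrite distrC (lt_le_trans zL).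
  have -> : z - l = (z - L t) + (L t - l) by ring.
  rewrite (le_lt_trans (ler_normD _ _))// -ltrBrDr; exact: lt_le_trans e1d.
- by move=> t /LP[].
Qed.

End Simple.

(** The two roots split off in two different ways agree as multisets once they
    avoid the roots of one of the cofactors. *)
Lemma pair_roots_unique (a b r s : C) (H K : {poly C}) :
  ('X - a%:P) * (('X - b%:P) * H) %= ('X - r%:P) * (('X - s%:P) * K) ->
  ~~ root H r -> ~~ root H s -> (r = a /\ s = b) \/ (r = b /\ s = a).
Proof.
move=> E Hr Hs.
have cancel (x : C) (p q : {poly C}) :
    ('X - x%:P) * p %= ('X - x%:P) * q -> p %= q.
  by rewrite eqp_mul2l ?polyXsubC_eq0.
have : root (('X - r%:P) * (('X - s%:P) * K)) r.
  by rewrite rootM root_XsubC eqxx.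
rewrite -(eqp_root E) !rootM !root_XsubC (negbTE Hr) orbF => /orP[/eqP ra|/eqP rb].
  left; split=> //; rewrite ra in E; have /eqp_root/(_ s) := cancel _ _ _ E.
  by rewrite !rootM !root_XsubC eqxx (negbTE Hs) orbF => /eqP.
right; split=> //; rewrite rb mulrCA in E; have /eqp_root/(_ s) := cancel _ _ _ E.
by rewrite !rootM !root_XsubC eqxx (negbTE Hs) orbF => /eqP.
Qed.

Section Double.
Variables (T : topologicalType) (G : T -> {poly C}).
Hypothesis G_loc : forall t, loc_poly_cvg G t.

(** Two applications of [poly_cvg_factor] to a local convergent associate. *)
Lemma double_factor t (a b : C) (p : {poly C}) : p != 0 ->
  G t %= ('X - a%:P) * (('X - b%:P) * p) ->
  exists (r s : T -> C) (K : T -> {poly C}) (q : {poly C}),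
    [/\ r @ nbhs t --> a, s @ nbhs t --> b, poly_cvg (nbhs t) K q, p %= q
      & \forall u \near t, G u %= ('X - (r u)%:P) * (('X - (s u)%:P) * K u)].
Proof.
move=> p0 E; have [H [Hc GH]] := G_loc t; have GHt := nbhs_singleton GH.
have Xn0 (x : C) : 'X - x%:P != 0 by rewrite polyXsubC_eq0.
have E' : H t %= ('X - a%:P) * (('X - b%:P) * p).
  by apply: eqp_trans E; rewrite eqp_sym.
have H0 : H t != 0.
  by apply: (eqp_neq0 (p := _ * _)); [rewrite eqp_sym; exact: E'|rewrite !mulf_neq0].
have Hl : root (H t) a by rewrite (eqp_root E') rootM root_XsubC eqxx.
have [r [K [q [ra Kq EH HE]]]] := poly_cvg_factor (FF := nbhs_filter t) Hc H0 Hl.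
have Eq : q %= ('X - b%:P) * p by move: E'; rewrite EH eqp_mul2l.
have q0 : q != 0 by apply: contraNneq H0 => q0; rewrite EH q0 mulr0.
have ql : root q b by rewrite (eqp_root Eq) rootM root_XsubC eqxx.
have [s [L [q' [sb Lq EK KE]]]] := poly_cvg_factor (FF := nbhs_filter t) Kq q0 ql.
exists r, s, L, q'; split; [exact: ra|exact: sb|exact: Lq| |].
  by move: Eq; rewrite EK eqp_mul2l// eqp_sym.
by apply: filterS3 GH HE KE => u GHu HEu <-; rewrite -HEu.
Qed.

Hypothesis G_real : forall t z, root (G t) z -> z \is Num.real.

Definition isolated_pair (l d : C) (p : {poly C}) (ab : R * R) :=
  [/\ `|ab.1%:C - l| < d, `|ab.2%:C - l| < d, ab.1 <= ab.2
    & exists2 H, p %= ('X - ab.1%:C%:P) * (('X - ab.2%:C%:P) * H)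
      & forall z, `|z - l| < d -> ~~ root H z].

Lemma isolated_pair_near t (l e : C) : 0 < e -> mup l (G t) = 2%N ->
  exists2 d, 0 < d <= e & \forall s \near t, exists ab, isolated_pair l d (G s) ab.
Proof.
move=> e0 m2; have G0 : G t != 0 by rewrite (mup_gt0_neq0 (x := l))// m2.
have [p Ep pl] := mup_factor l G0; rewrite m2 expr2 -mulrA in Ep.
have p0 : p != 0 by apply: contraNneq pl => ->; exact: root0.
have E : G t %= ('X - l%:P) * (('X - l%:P) * p) by rewrite -Ep eqpxx.
have [r [s [K [q [rl sl Kq pq GE]]]]] := double_factor p0 E.
have ql : ~~ root q l by rewrite -(eqp_root pq).
have [d1 d10 Kd] := nonroot_disk (FF := nbhs_filter t) Kq ql.
have [d d0 dd1] : exists2 d, 0 < d <= e & d <= d1.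
  have [h|h] := real_leP (gtr0_real e0) (gtr0_real d10).
    by exists e => //; rewrite e0 /=.
  by exists d1 => //; rewrite d10 ltW.
exists d => //; have /andP[d0' _] := d0.
have rd := cvgr_dist_lt (FF := nbhs_filter t) _ _ rl _ d0'.
have sd := cvgr_dist_lt (FF := nbhs_filter t) _ _ sl _ d0'.
apply: filterS2 (filterI GE Kd) (filterI rd sd) => u [GEu Kdu] [rdu sdu].
have Kdu' z : `|z - l| < d -> ~~ root (K u) z.
  by move=> zd; apply: Kdu; exact: lt_le_trans dd1.
rewrite distrC in rdu; rewrite distrC in sdu.
have /G_real/complex_realP[a ra] : root (G u) (r u).
  by rewrite (eqp_root GEu) !rootM root_XsubC eqxx.
have /G_real/complex_realP[b sb] : root (G u) (s u).
  by rewrite (eqp_root GEu) !rootM !root_XsubC eqxx orbT.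
rewrite ra in rdu GEu; rewrite sb in sdu GEu.
have [ab|ba] := leP a b.
  by exists (a, b); split=> //; exists (K u).
by exists (b, a); split=> //=; [exact: ltW|exists (K u) => //; rewrite mulrCA].
Qed.

(** Sorting is 1-Lipschitz: when two close pairs are matched in the crossed
    order, the sorted pairs are as close. *)
Lemma sorted_dist_swap (a b c d e : R) : a <= b -> c <= d ->
  `|a - d| < e -> `|b - c| < e -> `|a - c| < e /\ `|b - d| < e.
Proof.
move=> ab cd; rewrite !ltr_norml => /andP[h1 h2] /andP[h3 h4].
by split; apply/andP; split; lra.
Qed.

Lemma normcR (x : R) : `|x%:C| = `|x|%:C :> C.
Proof. by rewrite normc_def /= expr0n /= addr0 sqrtr_sqr. Qed.

(** L1 and L2 are the smaller and the larger of the two roots in the disk. At a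
    point t of Q the factorization of [double_factor] provides two roots
    that tend to L1 t and L2 t. Being in the disk eventually, they are L1 s and
    L2 s in some order, and [sorted_dist_swap] deals with the crossed order,
    which may occur when L1 t = L2 t. *)
Lemma double_root_continuation t0 (l e : C) : 0 < e -> mup l (G t0) = 2%N ->
  exists (Q : set T) (L1 L2 : T -> R),
    [/\ nbhs t0 Q, (L1 t0)%:C = l /\ (L2 t0)%:C = l,
        {within Q, continuous L1} /\ {within Q, continuous L2},
        forall t, Q t -> [/\ `|(L1 t)%:C - l| < e, L1 t <= L2 t
                           & `|(L2 t)%:C - l| < e]
      & forall t, Q t -> root (G t) (L1 t)%:C /\ root (G t) (L2 t)%:C].
Proof.
move=> e0 m2; have [d /andP[d0 de] near_d] := isolated_pair_near e0 m2.
pose L t := xget (0, 0) [set ab | isolated_pair l d (G t) ab].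
pose Q := [set t | exists ab, isolated_pair l d (G t) ab].
have LP t : Q t -> isolated_pair l d (G t) (L t).
  by move=> Qt; exact: xgetPex.
have continuity t : Q t -> forall e1 : R, 0 < e1 -> \forall s \near t, Q s ->
    `|(L t).1 - (L s).1| < e1 /\ `|(L t).2 - (L s).2| < e1.
  move=> Qt e1 e10; have [ad bd ab [H HE Hd]] := LP t Qt.
  have H0 : H != 0.
    by apply: contraNneq (Hd _ ad) => ->; exact: root0.
  have [u [v [K [q [ua vb _ _ GE]]]]] := double_factor H0 HE.
  have e1C : (0 : C) < e1%:C by rewrite ltcR.
  have ue := cvgr_dist_lt (FF := nbhs_filter t) _ _ ua _ e1C.
  have ve := cvgr_dist_lt (FF := nbhs_filter t) _ _ vb _ e1C.
  have ad' : 0 < d - `|(L t).1%:C - l| by rewrite subr_gt0.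
  have bd' : 0 < d - `|(L t).2%:C - l| by rewrite subr_gt0.
  have ud := cvgr_dist_lt (FF := nbhs_filter t) _ _ ua _ ad'.
  have vd := cvgr_dist_lt (FF := nbhs_filter t) _ _ vb _ bd'.
  apply: filterS3 GE (filterI ue ve) (filterI ud vd) => s GEs [ues ves] [uds vds] Qs.
  have [ads bds abs [Hs HsE Hsd]] := LP s Qs.
  have disk (x y : C) : `|x - y| < d - `|x - l| -> `|y - l| < d.
    move=> xy; have -> : y - l = (y - x) + (x - l) by ring.
    by rewrite (le_lt_trans (ler_normD _ _))// -ltrBrDr distrC.
  have EE := eqp_trans (etrans (eqp_sym _ _) HsE) GEs.
  have Hu := Hsd _ (disk _ _ uds); have Hv := Hsd _ (disk _ _ vds).
  have [[Eu Ev]|[Eu Ev]] := pair_roots_unique EE Hu Hv.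
  - move: ues ves; rewrite Eu Ev -!rmorphB !normcR !ltcR; by split.
  - move: ues ves; rewrite Eu Ev -!rmorphB !normcR !ltcR => h1 h2.
    exact: sorted_dist_swap h1 h2.
have cont1 : {within Q, continuous (fun t => (L t).1)}.
  apply/subspace_continuousP => t Qt; apply/cvgrPdist_lt => e1 e10.
  rewrite /within /=; apply: filterS (continuity t Qt e1 e10) => s Hs Qs.
  by have [] := Hs Qs.
have cont2 : {within Q, continuous (fun t => (L t).2)}.
  apply/subspace_continuousP => t Qt; apply/cvgrPdist_lt => e1 e10.
  rewrite /within /=; apply: filterS (continuity t Qt e1 e10) => s Hs Qs.
  by have [] := Hs Qs.
exists Q, (fun t => (L t).1), (fun t => (L t).2); split.
- exact: near_d.
- have Q0 := nbhs_singleton near_d; have [_ _ _ [H HE Hd]] := LP _ Q0.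
  have G0 : G t0 != 0 by rewrite (mup_gt0_neq0 (x := l))// m2.
  have [p Ep pl] := mup_factor l G0; rewrite m2 expr2 -mulrA in Ep.
  have Hl : ~~ root H l by apply: Hd; rewrite subrr normr0.
  have EE := HE; rewrite eqp_sym [X in _ %= X]Ep in EE.
  by have [[<- <-]|[<- <-]] := pair_roots_unique EE Hl Hl.
- by split.
- by move=> t /LP[h1 h2 h3 _]; split=> //; exact: lt_le_trans de.
- move=> t /LP[_ _ _ [H HE _]].
  by rewrite !(eqp_root HE) !rootM !root_XsubC !eqxx orbT.
Qed.

End Double.

End Continuation.

(** * Convergence of matrices *)

Local Open Scope sesquilinear_scope.
Local Open Scope quotient_scope.

Section MatrixCvg.
Variable R : realType.
Local Notation C := R[i].

Lemma lift0_I2 : lift 0 0 = 1 :> 'I_2.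
Proof. exact: val_inj. Qed.

Lemma det2 (S : comNzRingType) (A : 'M[S]_2) :
  \det A = A 0 0 * A 1 1 - A 0 1 * A 1 0.
Proof.
have l1 : lift 1 0 = 0 :> 'I_2 by exact: val_inj.
rewrite (expand_det_row _ 0) !big_ord_recl big_ord0 addr0 /cofactor !det_mx11 !mxE.
by rewrite /= !lift0_I2 !l1 expr0 expr1 mul1r mulN1r mulrN.
Qed.

Definition adj2 (A : 'M[C]_2) : 'M[C]_2 :=
  \matrix_(i, j) (if i == j then A (1 - i) (1 - j) else - A i j).

Lemma I2P (i : 'I_2) : i = 0 \/ i = 1.
Proof. by case: i => [[|[|//]] ?]; [left|right]; exact: val_inj. Qed.

(** Cramer's rule, which exhibits the inverse as continuous in the entries. *)
Lemma invmx2 (A : 'M[C]_2) : A \in unitmx -> invmx A = (\det A)^-1 *: adj2 A.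
Proof.
move=> uA; have dA : \det A != 0 by rewrite -unitfE -unitmxE.
suff E : A *m ((\det A)^-1 *: adj2 A) = 1%:M by rewrite -[RHS](mulKmx uA) E mulmx1.
rewrite -scalemxAr; apply/matrixP => i j; rewrite !mxE.
rewrite !big_ord_recl big_ord0 addr0 !mxE.
have e : 1 - 1 = 0 :> 'I_2 by exact: val_inj.
have [->|->] := I2P i; have [->|->] := I2P j; rewrite /= ?lift0_I2 ?e ?subr0 det2 in dA *;
 apply: (mulfI dA); rewrite mulrA mulfV// ?mulr0 ?mulr1; ring.
Qed.

Context {T : Type} {F : set_system T} {FF : Filter F}.

Definition mx_cvg m n (A : T -> 'M[C]_(m, n)) (A0 : 'M[C]_(m, n)) :=
  forall i j, (fun t => A t i j) @ F --> A0 i j.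

Lemma cvg_mx m n (A : T -> 'M[C]_(m, n)) (A0 : 'M[C]_(m, n)) :
  mx_cvg A A0 <-> A @ F --> A0.
Proof.
split=> h.
  move=> Q [P PA0 PQ].
  have FP i : F (fun t => forall j, P i j (A t i j)).
    by apply: filter_forall => j; exact: h.
  have FA : F (fun t => forall i j, P i j (A t i j)).
    by apply: filter_forall => i; exact: FP.
  by change (F (fun t => Q (A t))); apply: filterS FA => t At; exact: (PQ (A t) At).
move=> i j; exact: (cvg_comp _ _ h (@coord_continuous _ m n i j A0)).
Qed.

Lemma mx_cvgM m n p (A : T -> 'M[C]_(m, n)) (B : T -> 'M[C]_(n, p)) A0 B0 :
  mx_cvg A A0 -> mx_cvg B B0 -> mx_cvg (fun t => A t *m B t) (A0 *m B0).
Proof.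
move=> hA hB i j; rewrite mxE; under eq_fun do rewrite mxE.
apply: (@cvg_sumC _ _ F FF _ _ (fun (k : 'I_n) t => A t i k * B t k j)
  (fun k : 'I_n => A0 i k * B0 k j)) => k.
exact: (cvgM (hA i k) (hB k j)).
Qed.

Lemma mx_cvg_cst m n (A0 : 'M[C]_(m, n)) : mx_cvg (fun=> A0) A0.
Proof. by move=> i j; exact: cvg_cst. Qed.

Lemma mx_cvgD m n (A B : T -> 'M[C]_(m, n)) A0 B0 :
  mx_cvg A A0 -> mx_cvg B B0 -> mx_cvg (fun t => A t + B t) (A0 + B0).
Proof.
move=> hA hB i j; rewrite mxE; under eq_fun do rewrite mxE.
exact: (cvgD (hA i j) (hB i j)).
Qed.

Lemma mx_cvg_det (A : T -> 'M[C]_2) A0 : mx_cvg A A0 ->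
  (fun t => \det (A t)) @ F --> \det A0.
Proof.
move=> hA; rewrite det2; under eq_fun do rewrite det2.
exact: (cvgB (cvgM (hA 0 0) (hA 1 1)) (cvgM (hA 0 1) (hA 1 0))).
Qed.

Lemma mx_cvg_unit (A : T -> 'M[C]_2) A0 : mx_cvg A A0 -> A0 \in unitmx ->
  \forall t \near F, A t \in unitmx.
Proof.
rewrite unitmxE unitfE -normr_gt0 => hA dA0.
have := cvgr_dist_lt (FF := FF) _ _ (mx_cvg_det hA) _ dA0.
apply: filterS => t; rewrite unitmxE unitfE; apply: contraTneq => ->.
by rewrite subr0 ltxx.
Qed.

Lemma mx_cvg_inv (A : T -> 'M[C]_2) A0 : mx_cvg A A0 -> A0 \in unitmx ->
  mx_cvg (fun t => invmx (A t)) (invmx A0).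
Proof.
move=> hA uA0 i j; have dA0 : \det A0 != 0 by rewrite -unitfE -unitmxE.
have cadj : (fun t => adj2 (A t) i j) @ F --> adj2 A0 i j.
  rewrite mxE; under eq_fun do rewrite mxE.
  by case: (i == j); [exact: hA|exact: (cvgN (hA i j))].
rewrite (invmx2 uA0) mxE.
apply: cvg_trans (cvgM (cvgV dA0 (mx_cvg_det hA)) cadj).
apply: near_eq_cvg; apply: filterS (mx_cvg_unit hA uA0) => t uA.
by rewrite (invmx2 uA) mxE.
Qed.

End MatrixCvg.

(** * Continuity of the characteristic polynomial in the problem *)

Section GammaCvg.
Variables (R : realType) (N : nat).
Local Notation C := R[i].
Context {T : Type} {F : set_system T} {FF : Filter F}.

Lemma entry_cvg m (v : T -> 'rV[C]_m) v0 k : mx_cvg (F := F) v v0 ->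
  (fun t => entry (v t) k) @ F --> entry v0 k.
Proof.
move=> hv; rewrite /entry; case: insubP => [i _ _|_]; first exact: hv.
exact: cvg_cst.
Qed.

Definition coeffs_cvg (om : T -> coeffs R N) (om0 : coeffs R N) :=
  [/\ mx_cvg (F := F) (fun t => (om t).1.1) om0.1.1,
      mx_cvg (F := F) (fun t => (om t).1.2) om0.1.2
    & mx_cvg (F := F) (fun t => (om t).2) om0.2].

Lemma ivp_poly_cvg (om : T -> coeffs R N) om0 a b n : coeffs_cvg om om0 ->
  poly_cvg F (fun t => (ivp (om t) a b n).1) (ivp om0 a b n).1 /\
  poly_cvg F (fun t => (ivp (om t) a b n).2) (ivp om0 a b n).2.
Proof.
move=> [hf hq hw]; elim: n => [|n [IH1 IH2]] /=.
  by split; exact: poly_cvg_cst.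
set y0 := (ivp om0 a b n).1 + _; pose y t := (ivp (om t) a b n).1 +
  (coef_f (om t) n)^-1 *: (ivp (om t) a b n).2.
have yc : poly_cvg F y y0.
  apply: (poly_cvgD IH1); rewrite -mul_polyC.
  apply: (poly_cvg_eq (G := fun t => ((coef_f (om t) n)^-1)%:P * (ivp (om t) a b n).2)).
    by move=> t; rewrite mul_polyC.
  apply: (fun h => poly_cvgM h IH2); apply: poly_cvgC; rewrite /coef_f invrK.
  by under eq_fun do rewrite invrK; exact: entry_cvg.
split; first exact: yc.
apply: (poly_cvgD IH2); apply: (fun h => poly_cvgM h yc).
rewrite -mul_polyC -mulNr -polyCN.
apply: (poly_cvg_eq (G := fun t => (coef_q (om t) n.+1)%:P + (- coef_w (om t) n.+1)%:P * 'X)).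
  by move=> t; rewrite polyCN mulNr mul_polyC.
apply: poly_cvgD; first by apply: poly_cvgC; exact: entry_cvg.
apply: poly_cvgM; last exact: poly_cvg_cst.
by apply: poly_cvgC; apply: cvgN; exact: entry_cvg.
Qed.

Lemma poly_cvg_Gamma (om : T -> coeffs R N) om0 (A B : T -> 'M[C]_2) A0 B0 :
  coeffs_cvg om om0 -> mx_cvg (F := F) A A0 -> mx_cvg (F := F) B B0 ->
  poly_cvg F (fun t => Gamma_pair (om t) (A t) (B t)) (Gamma_pair om0 A0 B0).
Proof.
move=> hom hA hB.
pose M (A B : 'M[C]_2) (om : coeffs R N) (i j : 'I_2) : {poly C} :=
  (A i j)%:P +
  ((B i 0)%:P * (if j == 0 then (ivp om 1 0 N).1 else (ivp om 0 1 N).1) +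
   (B i 1)%:P * (if j == 0 then (ivp om 1 0 N).2 else (ivp om 0 1 N).2)).
have GE A1 B1 (om1 : coeffs R N) : Gamma_pair om1 A1 B1 =
    M A1 B1 om1 0 0 * M A1 B1 om1 1 1 - M A1 B1 om1 0 1 * M A1 B1 om1 1 0.
  by rewrite /Gamma_pair det2 !mxE !big_ord_recl !big_ord0 !addr0 !mxE /= !lift0_I2.
have Mc i j : poly_cvg F (fun t => M (A t) (B t) (om t) i j) (M A0 B0 om0 i j).
  have [h1 h2] := ivp_poly_cvg 1 0 N hom; have [h3 h4] := ivp_poly_cvg 0 1 N hom.
  apply: poly_cvgD; first by apply: poly_cvgC; exact: hA.
  by apply: poly_cvgD; apply: poly_cvgM; first [by apply: poly_cvgC; exact: hB|case: (j == 0)].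
rewrite GE -mulN1r.
apply: (poly_cvg_eq (G := fun t =>
  M (A t) (B t) (om t) 0 0 * M (A t) (B t) (om t) 1 1 +
  -1 * (M (A t) (B t) (om t) 0 1 * M (A t) (B t) (om t) 1 0))).
  by move=> t; rewrite GE mulN1r.
apply: poly_cvgD; first by apply: poly_cvgM; exact: Mc.
by apply: poly_cvgM; [exact: poly_cvg_cst|apply: poly_cvgM; exact: Mc].
Qed.

End GammaCvg.

(** * The space of boundary conditions *)

Lemma cvg_pair_nbhs (X Y : topologicalType) (T : Type) (F : set_system T)
    (FF : Filter F) (f : T -> X) (g : T -> Y) (x : X) (y : Y) :
  f @ F --> x -> g @ F --> y -> (fun t => (f t, g t)) @ F --> (x, y).
Proof.
move=> fx gy S [[A B] [/= hA hB] AB]; change (F (fun t => S (f t, g t))).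
have FA : F (fun t => A (f t)) := fx _ hA.
have FB : F (fun t => B (g t)) := gy _ hB.
by apply: filterS2 FA FB => t At Bt; apply: AB.
Qed.

Lemma cvg_set_val (X : topologicalType) (A : set X) (T : Type)
    (F : set_system T) (FF : Filter F) (f : T -> A) (a : A) :
  (fun t => set_val (f t)) @ F --> set_val a -> f @ F --> a.
Proof.
move=> h Q [U [[V oV VU] Ua UQ]].
change (F (fun t => Q (f t))).
have : F (fun t => V (set_val (f t))).
  apply: h; apply: open_nbhs_nbhs; split=> //.
  by move: Ua; rewrite -VU.
by apply: filterS => t Vt; apply: UQ; rewrite -VU.
Qed.

Lemma set_val_cvg (X : topologicalType) (A : set X) (a : A) :
  set_val @ nbhs a --> set_val a.
Proof. exact: (@initial_continuous A X set_val a). Qed.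

Section BoundarySpace.
Variable R : realType.
Local Notation C := R[i].
Implicit Types (P Q : 'M[C]_2 * 'M[C]_2) (T : 'M[C]_2).

Definition lmul_pair T P := (T *m P.1, T *m P.2).
Definition gram P Q := P.1 *m Q.1^t* + P.2 *m Q.2^t*.
Definition to_bc_pair P (h : bc_pair R P) : bc_pair R := exist _ P (mem_set h).

Lemma gramE P Q : gram P Q = row_mx P.1 P.2 *m (row_mx Q.1 Q.2)^t*.
Proof. by rewrite tr_row_mx map_col_mx mul_row_col. Qed.

Lemma gram_lmul T P Q : gram (lmul_pair T P) Q = T *m gram P Q.
Proof. by rewrite /gram /= mulmxDr !mulmxA. Qed.

Lemma mulmx_adj_eq0 n (u : 'rV[C]_n) : u *m u^t* = 0 -> u = 0.
Proof.
move=> /matrixP/(_ 0 0); rewrite !mxE => h; apply/rowP => j; rewrite mxE.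
have h2 : \sum_k `|u 0 k| ^+ 2 = 0.
  by apply: etrans h; apply: eq_bigr => k _; rewrite !mxE normCK.
have /eqP : `|u 0 j| ^+ 2 = 0.
  by apply: (psumr_eq0P _ h2) => // k _; exact: exprn_ge0.
by rewrite sqrf_eq0 normr_eq0 => /eqP.
Qed.

(** Let W be the 2 by 4 matrix of P, and W' its adjoint. A row vector v with
    v W W' = 0 satisfies (v W)(v W)' = 0, so v W = 0, and W has rank 2. *)
Lemma gram_unit P : bc_pair R P -> gram P P \in unitmx.
Proof.
move=> rP; rewrite unitmxE unitfE; apply/det0P => -[v v0].
rewrite gramE mulmxA => h.
have /mulmx_adj_eq0 vW : (v *m row_mx P.1 P.2) *m (v *m row_mx P.1 P.2)^t* = 0.
  by rewrite trmx_mul map_mxM mulmxA h mul0mx.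
have fW : row_free (row_mx P.1 P.2) by rewrite /row_free rP.
by move/eqP: vW; rewrite mulmx_free_eq0// (negbTE v0).
Qed.

(** Rank 2 is certified by an invertible Gram matrix with any other pair. This
    is how all pairs constructed below are seen to be boundary conditions. *)
Lemma gram_bc_pair P Q : gram P Q \in unitmx -> bc_pair R P.
Proof.
rewrite gramE -row_free_unit /bc_pair /= => /eqP h.
apply/eqP; rewrite eqn_leq rank_leq_row /=.
by rewrite -[leqLHS]h mxrankM_maxl.
Qed.

Lemma bc_pair_lmul T P : T \in unitmx -> bc_pair R P -> bc_pair R (lmul_pair T P).
Proof.
by move=> uT bP; apply: (@gram_bc_pair _ P); rewrite gram_lmul unitmx_mul uT gram_unit.
Qed.

Lemma pi_eqP (P Q : bc_pair R) : reflect
  (exists2 T, T \in unitmx & set_val Q = lmul_pair T (set_val P))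
  (\pi_(bc_space R) P == \pi_(bc_space R) Q).
Proof.
apply: (iffP idP) => [/eqP/eqmodP/asboolP//|h].
by apply/eqP/eqmodP/asboolP.
Qed.

Lemma cvg_pairP (T : Type) (F : set_system T) (FF : Filter F)
    (P : T -> 'M[C]_2 * 'M[C]_2) P0 :
  mx_cvg (F := F) (fun t => (P t).1) P0.1 -> mx_cvg (F := F) (fun t => (P t).2) P0.2 ->
  P @ F --> P0.
Proof.
case: P0 => A0 B0 /cvg_mx h1 /cvg_mx h2.
have -> : P = (fun t => ((P t).1, (P t).2)) by apply/funext => t; case: (P t).
exact: (cvg_pair_nbhs FF h1 h2).
Qed.

Lemma val_mx_cvg (P0 : bc_pair R) :
  mx_cvg (F := nbhs P0) (fun P : bc_pair R => (set_val P).1) (set_val P0).1 /\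
  mx_cvg (F := nbhs P0) (fun P : bc_pair R => (set_val P).2) (set_val P0).2.
Proof.
have vc := @set_val_cvg _ _ P0.
have c1 := cvg_comp _ _ vc (@cvg_fst _ _ (nbhs (set_val P0).1) (nbhs (set_val P0).2) _).
have c2 := cvg_comp _ _ vc (@cvg_snd _ _ (nbhs (set_val P0).1) (nbhs (set_val P0).2) _).
by split; apply/cvg_mx; [exact: c1|exact: c2].
Qed.

(** The projection to the quotient is open: the saturation of an open set is
    the union of its preimages under the homeomorphisms (A, B) |-> (TA, TB). *)
Lemma nbhs_pi (P : bc_pair R) (S : set (bc_space R)) :
  nbhs P (fun P' : bc_pair R => S (\pi_(bc_space R) P')) -> nbhs (\pi_(bc_space R) P) S.
Proof.
rewrite nbhsE => -[U [oU UP] US].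
pose V : set (bc_space R) := [set b | exists2 P' : bc_pair R, U P' & b = \pi_(bc_space R) P'].
rewrite nbhsE; exists V; last by move=> _ [P' UP' ->]; exact: US.
split; last by exists P.
have : open (\pi_(bc_space R) @^-1` V); last by [].
rewrite openE => P1 [P2 UP2 /eqP/pi_eqP[T uT E]].
pose f (P' : bc_pair R) : bc_pair R := to_bc_pair (bc_pair_lmul uT (set_valP P')).
have fP1 : f P1 = P2 by apply: val_inj; exact: esym E.
have fc : f @ nbhs P1 --> f P1.
  have [h1 h2] := val_mx_cvg P1.
  have Tc := @mx_cvg_cst _ _ _ (nbhs_filter P1) _ _ T.
  apply: (cvg_set_val (nbhs_filter P1)).
  by apply: cvg_pairP; [exact: (mx_cvgM Tc h1)|exact: (mx_cvgM Tc h2)].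
have : nbhs P1 (f @^-1` U) by apply: fc; rewrite fP1; exact: open_nbhs_nbhs.
rewrite /interior; apply: filterS => P' UfP'; exists (f P') => //.
by apply/eqP/pi_eqP; exists T.
Qed.

End BoundarySpace.

(** * Local normal forms of boundary conditions *)

Section Canonical.
Variable R : realType.
Local Notation C := R[i].
Implicit Types (P Q : 'M[C]_2 * 'M[C]_2) (T : 'M[C]_2).

(** The component of P along P0: as 2 by 4 matrices, P is gauge P0 P times P0
    plus a matrix whose rows are orthogonal to those of P0. *)
Definition gauge P0 P := gram P P0 *m invmx (gram P0 P0).
Definition gauge_fix P0 P := lmul_pair (invmx (gauge P0 P)) P.

Lemma gauge_id P0 : bc_pair R P0 -> gauge P0 P0 = 1%:M.
Proof. by move=> h; rewrite /gauge mulmxV// gram_unit. Qed.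

Lemma gauge_fix_id P0 : bc_pair R P0 -> gauge_fix P0 P0 = P0.
Proof.
by move=> h; rewrite /gauge_fix gauge_id// /lmul_pair invmx1 !mul1mx -surjective_pairing.
Qed.

Lemma gauge_lmul P0 T P : gauge P0 (lmul_pair T P) = T *m gauge P0 P.
Proof. by rewrite /gauge gram_lmul mulmxA. Qed.

Lemma gauge_fix_lmul P0 T P : T \in unitmx -> gauge P0 P \in unitmx ->
  gauge_fix P0 (lmul_pair T P) = gauge_fix P0 P.
Proof.
move=> uT ug; rewrite /gauge_fix gauge_lmul /lmul_pair /=.
have E (X : 'M[C]_2) : invmx (T *m gauge P0 P) *m (T *m X) = invmx (gauge P0 P) *m X.
  have u : T *m gauge P0 P \in unitmx by rewrite unitmx_mul uT.
  by apply: (can_inj (mulKmx u)); rewrite mulKVmx// -mulmxA mulKVmx.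
by rewrite !E.
Qed.

Lemma gauge_fixK P0 P : gauge P0 P \in unitmx -> lmul_pair (gauge P0 P) (gauge_fix P0 P) = P.
Proof. by move=> u; rewrite /gauge_fix /lmul_pair /= !mulKVmx// -surjective_pairing. Qed.

(** The representative whose component along P0 is 1. It is meaningful for the
    classes b whose representatives have an invertible gauge, which include all
    those near the class of P0. *)
Definition normal_rep P0 (b : bc_space R) := gauge_fix P0 (set_val (repr b)).

Lemma bc_repr (P : bc_pair R) : exists2 T, T \in unitmx &
  set_val (repr (\pi_(bc_space R) P)) = lmul_pair T (set_val P).
Proof.
have /pi_eqP[T uT E] : \pi_(bc_space R) P == \pi_(bc_space R) (repr (\pi_(bc_space R) P)).
  by rewrite reprK.
by exists T.
Qed.

Lemma gauge_repr P0 (P : bc_pair R) :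
  gauge P0 (set_val (repr (\pi_(bc_space R) P))) \in unitmx =
    (gauge P0 (set_val P) \in unitmx).
Proof. by have [T uT ->] := bc_repr P; rewrite gauge_lmul unitmx_mul uT. Qed.

Lemma normal_rep_pi P0 (P : bc_pair R) : gauge P0 (set_val P) \in unitmx ->
  normal_rep P0 (\pi_(bc_space R) P) = gauge_fix P0 (set_val P).
Proof.
by move=> u; rewrite /normal_rep; have [T uT ->] := bc_repr P; rewrite gauge_fix_lmul.
Qed.

Lemma gauge_cvg (U : Type) (F : set_system U) (FF : Filter F)
    (P : U -> 'M[C]_2 * 'M[C]_2) P0 Q :
  mx_cvg (F := F) (fun t => (P t).1) Q.1 -> mx_cvg (F := F) (fun t => (P t).2) Q.2 ->
  mx_cvg (F := F) (fun t => gauge P0 (P t)) (gauge P0 Q).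
Proof.
move=> h1 h2; apply: mx_cvgM; last exact: mx_cvg_cst.
by apply: mx_cvgD; [apply: (mx_cvgM h1)|apply: (mx_cvgM h2)]; exact: mx_cvg_cst.
Qed.

Lemma gauge_unit_near (P0 : bc_pair R) :
  nbhs P0 (fun P : bc_pair R => gauge (set_val P0) (set_val P) \in unitmx).
Proof.
have [h1 h2] := val_mx_cvg P0.
have g := gauge_cvg (P0 := set_val P0)
  (P := fun P : bc_pair R => set_val P) (nbhs_filter P0) h1 h2.
have u : gauge (set_val P0) (set_val P0) \in unitmx.
  by rewrite gauge_id ?unitmx1//; exact: set_valP.
exact: (@mx_cvg_unit _ _ _ (nbhs_filter P0) _ _ g u).
Qed.

Lemma gauge_repr_unit_near (P0 : bc_pair R) :
  nbhs (\pi_(bc_space R) P0) (fun b => gauge (set_val P0) (set_val (repr b)) \in unitmx).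
Proof.
by apply: nbhs_pi; apply: filterS (gauge_unit_near P0) => P; rewrite gauge_repr.
Qed.

(** By [nbhs_pi] it suffices to follow the class of a pair P tending to P0, and
    there the representative is an explicit continuous function of P. *)
Lemma normal_rep_cvg_pair (P0 : bc_pair R) :
  normal_rep (set_val P0) @ nbhs (\pi_(bc_space R) P0) --> set_val P0.
Proof.
move=> S nS; apply: nbhs_pi.
have [h1 h2] := val_mx_cvg P0.
have bP0 := set_valP P0.
have hi := mx_cvg_inv (gauge_cvg (P0 := set_val P0)
  (P := fun P : bc_pair R => set_val P) (nbhs_filter P0) h1 h2).
rewrite gauge_id// in hi; have {}hi := hi (nbhs_filter P0) (unitmx1 _ _).
have m1 := @mx_cvgM _ _ _ (nbhs_filter P0) _ _ _ _ _ _ _ hi h1.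
have m2 := @mx_cvgM _ _ _ (nbhs_filter P0) _ _ _ _ _ _ _ hi h2.
rewrite invmx1 mul1mx in m1; rewrite invmx1 mul1mx in m2.
have cc := @cvg_pairP _ _ _ (nbhs_filter P0)
  (fun P : bc_pair R => gauge_fix (set_val P0) (set_val P)) _ m1 m2.
apply: filterS2 (gauge_unit_near P0) (cc S nS) => P u SP.
by rewrite /preimage /mkset (normal_rep_pi u).
Qed.

Lemma normal_rep_cvg (P0 : bc_pair R) :
  mx_cvg (F := nbhs (\pi_(bc_space R) P0))
    (fun b => (normal_rep (set_val P0) b).1) (set_val P0).1 /\
  mx_cvg (F := nbhs (\pi_(bc_space R) P0))
    (fun b => (normal_rep (set_val P0) b).2) (set_val P0).2.
Proof.
have c := @normal_rep_cvg_pair P0.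
have c1 := cvg_comp _ _ c (@cvg_fst _ _ (nbhs (set_val P0).1) (nbhs (set_val P0).2) _).
have c2 := cvg_comp _ _ c (@cvg_snd _ _ (nbhs (set_val P0).1) (nbhs (set_val P0).2) _).
by split; apply/cvg_mx; [exact: c1|exact: c2].
Qed.

Variable N : nat.

Definition Gamma_of (p : coeffs R N * bc_space R) : {poly C} :=
  Gamma_pair p.1 (bcA p.2) (bcB p.2).

(** The continuous associate is Gamma computed on [normal_rep], which differs
    from the chosen representative by the invertible matrix [gauge]. *)
Lemma Gamma_loc_poly_cvg p : loc_poly_cvg Gamma_of p.
Proof.
case: p => om1 bc1; pose P0 := repr bc1.
have E1 : \pi_(bc_space R) P0 = bc1 by rewrite reprK.
exists (fun p => Gamma_pair p.1 (normal_rep (set_val P0) p.2).1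
  (normal_rep (set_val P0) p.2).2); split.
  have EV : normal_rep (set_val P0) (om1, bc1).2 = set_val P0.
    by rewrite /normal_rep -/P0 gauge_fix_id//; exact: set_valP.
  rewrite EV.
  have [h1 h2] := normal_rep_cvg P0; rewrite E1 in h1 h2.
  have cf := @cvg_fst _ _ (nbhs om1) (nbhs bc1) (nbhs_filter _).
  have cs := @cvg_snd _ _ (nbhs om1) (nbhs bc1) (nbhs_filter _).
  have c1 := cvg_comp _ _ cf (@cvg_fst _ _ (nbhs om1.1) (nbhs om1.2) (nbhs_filter _)).
  have c2 := cvg_comp _ _ cf (@cvg_snd _ _ (nbhs om1.1) (nbhs om1.2) (nbhs_filter _)).
  have c11 := cvg_comp _ _ c1 (@cvg_fst _ _ (nbhs om1.1.1) (nbhs om1.1.2) (nbhs_filter _)).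
  have c12 := cvg_comp _ _ c1 (@cvg_snd _ _ (nbhs om1.1.1) (nbhs om1.1.2) (nbhs_filter _)).
  apply: (poly_cvg_Gamma (FF := nbhs_filter (om1, bc1))).
  - by split; apply/cvg_mx; [exact: c11|exact: c12|exact: c2].
  - by move=> i j; exact: (cvg_comp _ _ cs (h1 i j)).
  - by move=> i j; exact: (cvg_comp _ _ cs (h2 i j)).
have un := gauge_repr_unit_near P0; rewrite E1 in un.
have un' : \forall p \near (om1, bc1), gauge (set_val P0) (set_val (repr p.2)) \in unitmx.
  exact: (@cvg_snd _ _ (nbhs om1) (nbhs bc1) (nbhs_filter _)) _ un.
apply: filterS un' => -[om b] /= u.
rewrite /Gamma_of /bcA /bcB /=; set P := set_val (repr b) in u *.
have EP := gauge_fixK u.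
rewrite -[P in X in X %= _]EP /= Gamma_pair_mul.
by rewrite eqp_scale// -unitfE -unitmxE.
Qed.

End Canonical.

(** * Isotropic row spaces and self-adjoint boundary conditions *)

Section SelfAdjoint.
Variable R : realType.
Local Notation C := R[i].

Lemma adjmxM m n p (A : 'M[C]_(m, n)) (B : 'M[C]_(n, p)) :
  (A *m B)^t* = B^t* *m A^t*.
Proof. by rewrite trmx_mul map_mxM. Qed.

Lemma adjmxK m n (A : 'M[C]_(m, n)) : A^t*^t* = A.
Proof. by apply/matrixP => i j; rewrite !mxE conjCK. Qed.

(** Here J is an anti-Hermitian complex structure, and the row space of W is
    a maximal isotropic subspace for the form x J y', with y' the adjoint of y.
    The rows of W J span another isotropic subspace, which is the orthogonal
    complement of the row space of W. *)
Section Complement.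
Variables (n : nat) (W : 'M[C]_(n, n + n)) (J : 'M[C]_(n + n)).
Hypotheses (JC : J^t* = - J) (J2 : J *m J = - 1%:M).
Hypotheses (uW : W *m W^t* \in unitmx) (isoW : W *m J *m W^t* = 0).

(** The sum of the orthogonal projections on the row spaces of W and W J. The
    square matrix with blocks W and W J has a right inverse, since W and W J
    have the same Gram matrix and are orthogonal to each other. The right
    inverse is also a left inverse, which is the identity below. *)
Lemma isotropic_resolution :
  W^t* *m invmx (W *m W^t*) *m W +
  J^t* *m W^t* *m invmx (W *m W^t*) *m (W *m J) = 1%:M.
Proof.
set K := W *m W^t*; rewrite -mul_row_col; apply: mulmx1C.
rewrite mul_col_row !mulmxA -/K mulmxV// isoW mul0mx JC mulmxN !mulNmx isoW mul0mx oppr0.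
rewrite mulmxN -[W *m J *m J]mulmxA J2 mulmxN mulmx1 opprK -/K.
by rewrite mulmxV// -scalar_mx_block.
Qed.

Lemma isotropic_image : W *m J *m J *m (W *m J)^t* = 0.
Proof.
rewrite adjmxM JC -[W *m J *m J]mulmxA J2 mulmxN mulmx1 mulNmx mulNmx mulmxN opprK.
by rewrite mulmxA isoW.
Qed.

Lemma ortho_isotropic m (V : 'M[C]_(m, n + n)) :
  V *m W^t* = 0 -> V *m J *m V^t* = 0.
Proof.
move=> VW; pose Z := V *m J^t* *m W^t* *m invmx (W *m W^t*).
have EV : V = Z *m (W *m J).
  by rewrite -[LHS]mulmx1 -isotropic_resolution mulmxDr !mulmxA VW !mul0mx add0r.
have E U : Z *m U *m J *m (Z *m U)^t* = Z *m (U *m J *m U^t*) *m Z^t*.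
  by rewrite adjmxM !mulmxA.
by rewrite EV E isotropic_image mulmx0 mul0mx.
Qed.

(** A column killed by W is a combination of the columns of the adjoint of
    W J. *)
Lemma kernel_isotropic (y : 'cV[C]_(n + n)) : W *m y = 0 -> y^t* *m J *m y = 0.
Proof.
move=> Wy; pose d := invmx (W *m W^t*) *m (W *m J) *m y.
have -> : y = (W *m J)^t* *m d.
  rewrite -[LHS]mul1mx -isotropic_resolution mulmxDl -!mulmxA Wy !mulmx0 add0r.
  by rewrite adjmxM /d !mulmxA.
have E (U : 'M[C]_(n, n + n)) :
    (U^t* *m d)^t* *m J *m (U^t* *m d) = d^t* *m (U *m J *m U^t*) *m d.
  by rewrite adjmxM adjmxK !mulmxA.
by rewrite E isotropic_image mulmx0 mul0mx.
Qed.

End Complement.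

Lemma Emx_adj : (@Emx R)^t* = - @Emx R.
Proof.
apply/matrixP => i j; rewrite !mxE.
have [->|->] := I2P i; have [->|->] := I2P j;
  by rewrite /= ?rmorphN ?rmorph1 ?rmorph0 ?oppr0 ?opprK.
Qed.

Lemma Emx_sqr : @Emx R *m @Emx R = - 1%:M.
Proof.
apply/matrixP => i j; rewrite !mxE !big_ord_recl big_ord0 !mxE lift0_I2.
have [->|->] := I2P i; have [->|->] := I2P j; rewrite /=; ring.
Qed.

(** The form on pairs (state at 0, state at N) whose isotropic planes are the
    self-adjoint boundary conditions. *)
Definition Jmx : 'M[C]_(2 + 2) := block_mx (@Emx R) 0 0 (- @Emx R).

Lemma Jmx_adj : Jmx^t* = - Jmx.
Proof.
rewrite /Jmx tr_block_mx map_block_mx opp_block_mx !trmx0 !map_mx0 !oppr0.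
by rewrite linearN /= map_mxN Emx_adj.
Qed.

Lemma Jmx_sqr : Jmx *m Jmx = - 1%:M.
Proof.
rewrite /Jmx mulmx_block !mul0mx !mulmx0 !addr0 !add0r mulmxN mulNmx opprK Emx_sqr.
by rewrite [in RHS]scalar_mx_block opp_block_mx !oppr0.
Qed.

Lemma sa_pairE (A B : 'M[C]_2) : sa_pair A B <->
  row_mx A B *m Jmx *m (row_mx A B)^t* = 0.
Proof.
rewrite /sa_pair /Jmx mul_row_block !mulmx0 addr0 add0r tr_row_mx map_col_mx mul_row_col.
rewrite mulmxN mulNmx; split=> [->|/eqP]; first by rewrite subrr.
by rewrite subr_eq0 => /eqP.
Qed.

Lemma sa_boundary (A B : 'M[C]_2) (u v : 'cV[C]_2) : bc_pair R (A, B) ->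
  sa_pair A B -> A *m u + B *m v = 0 ->
  u^t* *m @Emx R *m u = v^t* *m @Emx R *m v.
Proof.
move=> /gram_unit; rewrite gramE /= => uW /sa_pairE iso; rewrite -mul_row_col => h.
have := kernel_isotropic Jmx_adj Jmx_sqr uW iso h.
rewrite tr_col_mx map_row_mx /Jmx mul_row_block !mulmx0 addr0 add0r mul_row_col.
by rewrite mulmxN mulNmx => /eqP; rewrite subr_eq0 => /eqP.
Qed.

End SelfAdjoint.

(** * Eigenvalues as roots of the characteristic polynomial *)

Section Eigenvalues.
(* With this scope closed, z^* is the conjugation of a numClosedFieldType. *)
Local Close Scope complex_scope.

Variables (R : realType) (N : nat).
Local Notation C := (complex R).
Implicit Types (om : coeffs R N) (A B : 'M[C]_2).

Lemma ivp_linear om a b n lam :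
  (ivp om a b n).1.[lam] = a * (ivp om 1 0 n).1.[lam] + b * (ivp om 0 1 n).1.[lam] /\
  (ivp om a b n).2.[lam] = a * (ivp om 1 0 n).2.[lam] + b * (ivp om 0 1 n).2.[lam].
Proof.
elim: n => [|n [IH1 IH2]] /=; first by rewrite !hornerE; split; ring.
by rewrite !hornerE IH1 IH2; split; ring.
Qed.

(** A kernel vector (a, b) of A + B Phi_N(lam) gives the initial values of an
    eigenfunction. Either y_0 = a is nonzero, or y_1 = b / f_0 is. *)
Lemma root_Gamma_eigenvalue om A B lam : OmegaC R N om ->
  root (Gamma_pair om A B) lam -> eigenvalue_pair om A B lam.
Proof.
move=> hom /eqP; rewrite /Gamma_pair -[LHS]/(horner_eval lam _) -det_map_mx.
set M := map_mx _ _; rewrite -det_tr => /eqP/det0P[v v0 vM].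
have Mv : M *m v^T = 0 by rewrite -[M]trmxK -trmx_mul vM trmx0.
pose a := v 0 0; pose b := v 0 1.
pose y n := (ivp om a b n).1.[lam].
have [sy y0 yz] := ivp_solves lam a b hom.
exists y; split=> //.
  have [a0|a0] := eqVneq a 0; last by exists 0%N => //; rewrite [y 0%N]y0.
  exists 1%N => //; rewrite /y /= !hornerE a0 add0r.
  apply: mulf_neq0; first by rewrite invr_neq0// coef_f_neq0.
  apply: contraNneq v0 => b0; apply/eqP/rowP => j; rewrite mxE.
  by have [->|->] := I2P j.
have stE n : (n <= N)%N -> state om y n =
    \col_(i < 2) (if i == 0 then (ivp om a b n).1.[lam] else (ivp om a b n).2.[lam]).
  by move=> nN; apply/matrixP => i j; rewrite !mxE yz.
rewrite !stE// -[RHS]Mv /M map_mxD map_mxM mulmxDl -!map_mx_comp -mulmxA.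
have cE (X : 'M[C]_2) : map_mx (horner_eval lam \o polyC) X = X.
  by apply/matrixP => i j; rewrite mxE /= /horner_eval hornerC.
rewrite !cE; congr (_ + _); [congr (A *m _)|congr (B *m _)].
  by apply/matrixP => i j; rewrite !mxE /= !hornerC (ord1 j); have [->|->] := I2P i.
apply/matrixP => i j; rewrite !mxE !big_ord_recl big_ord0 addr0 !mxE (ord1 j) lift0_I2.
have [h1 h2] := ivp_linear om a b N lam.
by have [->|->] := I2P i; rewrite /= /horner_eval /= ?h1 ?h2 -/a -/b; ring.
Qed.

Lemma entry_real m (v : 'rV[C]_m) k : (forall i, v 0 i \is Num.real) ->
  entry v k \is Num.real.
Proof. by move=> h; rewrite /entry; case: insubP. Qed.

(** The discrete Lagrange identity between n - 1 and n, written in terms of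
    y = y_n and z = f_(n-1) (Delta y)_(n-1), so that y - z / f is y_(n-1) and
    z + (q - lam w) y is f_n (Delta y)_n. *)
Lemma wronskian_step (y z f q lam w : C) : f^* = f -> q^* = q -> w^* = w ->
  y^* * (z + (q - lam * w) * y) - y * (z + (q - lam * w) * y)^* =
  ((y - z / f)^* * z - (y - z / f) * z^*) + (lam^* - lam) * (w * (y * y^*)).
Proof.
move=> fr qr wr.
rewrite !(rmorphB, rmorphD, rmorphM) /= fmorphV /= fr qr wr.
by ring.
Qed.

(** Summing the Lagrange identity, the boundary terms cancel by
    [sa_boundary], and (conj lam - lam) times the sum of the w_n |y_n|^2 is 0.
    If that sum vanished, then y_1 = ... = y_N = 0. As N >= 2, this kills
    f_1 (Delta y)_1, hence all differences by the equation, and y = 0. *)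
Lemma selfadjoint_eigenvalue_real om A B lam : (2 <= N)%N ->
  OmegaRpos R N om -> bc_pair R (A, B) -> sa_pair A B ->
  eigenvalue_pair om A B lam -> lam \is Num.real.
Proof.
move=> N2 [hom fR qR w0] bAB sAB [y [[m mN ym] sy bcy]].
pose f n := coef_f om n; pose z n := f n * fdiff y n.
pose w n := coef_w om n.
have fr n : (f n)^* = f n.
  by apply: conj_Creal; rewrite /f /coef_f realV entry_real.
have f0 n : (n <= N)%N -> f n != 0 by exact: coef_f_neq0.
have wpos n : (0 < n <= N)%N -> 0 < w n.
  by case: n => // n nN; rewrite /w /coef_w /entry /= insubT.
have qr n : (coef_q om n)^* = coef_q om n.
  by apply: conj_Creal; rewrite entry_real.
have wr n : (w n)^* = w n.
  by apply: conj_Creal; rewrite entry_real// => i; exact: gtr0_real.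
pose Wr n := (y n)^* * z n - y n * (z n)^*.
have WrE n : ((state om y n)^t* *m @Emx R *m state om y n) 0 0 = Wr n.
  rewrite !mxE !big_ord_recl big_ord0 addr0 !mxE !big_ord_recl !big_ord0 !addr0 !mxE.
  rewrite lift0_I2 /=.
  by rewrite /Wr /z /f; ring.
have step n : (n < N)%N ->
    Wr n.+1 = Wr n + (lam^* - lam) * (w n.+1 * (y n.+1 * (y n.+1)^*)).
  move=> nN; have yS : y n = y n.+1 - z n / f n.
    by rewrite /z mulrAC mulfV ?f0 ?(ltnW nN)// mul1r /fdiff opprB addrC subrK.
  have zS : z n.+1 = z n + (coef_q om n.+1 - lam * w n.+1) * y n.+1.
    have := sy n.+1 nN; rewrite /bdiff /= -/(f n) -/(f n.+1) -/(z n) -/(z n.+1) -/(w n.+1).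
    move: (z n.+1) (z n) => z1 z0 E.
    have -> : z1 = z0 + coef_q om n.+1 * y n.+1 -
      (- (z1 - z0) + coef_q om n.+1 * y n.+1) by ring.
    by rewrite E; ring.
  by rewrite /Wr zS [in RHS]yS; apply: wronskian_step.
have Wrsum n : (n <= N)%N -> Wr n = Wr 0%N +
    (lam^* - lam) * \sum_(k < n) (w k.+1 * (y k.+1 * (y k.+1)^*)).
  elim: n => [|n IH] nN; first by rewrite big_ord0 mulr0 addr0.
  by rewrite step// IH ?(ltnW nN)// big_ord_recr /= mulrDr addrA.
have bd : Wr 0%N = Wr N.
  by rewrite -!WrE (sa_boundary bAB sAB bcy).
have tpos k : (k < N)%N -> 0 <= w k.+1 * (y k.+1 * (y k.+1)^*).
  by move=> kN; rewrite mulr_ge0 ?(ltW (wpos _ _))// mul_conjC_ge0.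
have /eqP := Wrsum N (leqnn N); rewrite -bd -subr_eq0 opprD addrA subrr add0r oppr_eq0.
rewrite mulf_eq0 => /orP[|/eqP S0]; first by rewrite subr_eq0 => /eqP h; apply/CrealP.
exfalso.
have yk k : (k < N)%N -> y k.+1 = 0.
  move=> kN; have /eqP : w k.+1 * (y k.+1 * (y k.+1)^*) = 0.
    by apply: (psumr_eq0P _ S0 (i := Ordinal kN)) => // i _; exact: tpos.
  by rewrite mulf_eq0 gt_eqF ?wpos//= mul_conjC_eq0 => /eqP.
have yall : forall n, (n <= N.+1)%N -> y n = 0.
  have zconst n : (n < N)%N -> z n.+1 = z n.
    move=> nN; have := sy n.+1 nN.
    rewrite yk// !mulr0 addr0 /bdiff /= => /eqP.
    by rewrite oppr_eq0 subr_eq0 => /eqP.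
  have zf n : (n <= N)%N -> z n = 0 -> y n.+1 = y n.
    move=> nN /eqP; rewrite mulf_eq0 (negbTE (f0 _ nN)) /= subr_eq0.
    by move=> /eqP.
  have z1 : z 1%N = 0.
    by rewrite /z /fdiff yk ?yk ?subrr ?mulr0// ltnW.
  have z0 n : (n <= N)%N -> z n = 0.
    elim: n => [|n IH] nN; first by rewrite -zconst// ltnW.
    by rewrite zconst// IH// ltnW.
  have y0 : y 0%N = 0 by rewrite -(zf 0%N) ?z0// yk// ltnW.
  elim=> // n IH nN; rewrite zf ?z0//; exact: IH (ltnW nN).
by move: ym; rewrite yall// eqxx.
Qed.

End Eigenvalues.

(** * Local star-shapedness and connected neighborhoods *)

Section LocallyStarShaped.
Variable R : realType.

(** Arbitrarily small neighborhoods of x, from every point of which in A a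
    path leads to x within A and the neighborhood. The set A is kept apart from
    the ambient space because the neighborhoods and the paths are constructed
    there, before they are restricted to the subspace A. *)
Definition locally_star_in (X : topologicalType) (A : set X) (x : X) :=
  forall Q, nbhs x Q -> exists M, [/\ nbhs x M, M `<=` Q &
    forall y, M y -> A y -> exists g : R -> X,
      [/\ continuous g, g 0 = x, g 1 = y & forall t, 0 <= t <= 1 -> M (g t) /\ A (g t)]].

(** Retracts the line on [0, 1], to make paths that stay in A during [0, 1]
    into functions on the whole line with values in A. *)
Definition clamp (t : R) : R := Num.max 0 (Num.min t 1).

Lemma clamp_continuous : continuous clamp.
Proof.
move=> t; apply: (continuous_comp (f := fun t : R => Num.min t 1) (g := fun t => Num.max 0 t)).
  by apply: continuous_min; [exact: cvg_id|exact: cvg_cst].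
by apply: continuous_max; [exact: cvg_cst|exact: cvg_id].
Qed.

Lemma clamp_itv t : 0 <= clamp t <= 1.
Proof. by rewrite /clamp le_max lexx /= ge_max ler01 ge_min lexx orbT. Qed.

Lemma clamp_id t : 0 <= t <= 1 -> clamp t = t.
Proof. by move=> /andP[t0 t1]; rewrite /clamp min_l// max_r. Qed.

Lemma locally_star_sub (X : topologicalType) (A : set X) (x : A) :
  locally_star_in A (set_val x) -> locally_star_in [set: A] x.
Proof.
move=> H Q; rewrite {1}/nbhs /=.
case=> U [[V oV VU] Ux UQ].
have nV : nbhs (set_val x) V.
  by apply: open_nbhs_nbhs; split=> //; move: Ux; rewrite -VU.
have [M [nM MV Mg]] := H V nV.
exists (set_val @^-1` M); split.
- exact: (set_val_cvg nM).
- by move=> y My; apply: UQ; rewrite -VU; exact: MV.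
move=> y My _; have [g [gc g0 g1 gM]] := Mg _ My (set_valP y).
have gA t : A (g (clamp t)) by have [] := gM _ (clamp_itv t).
exists (fun t => exist _ (g (clamp t)) (mem_set (gA t))); split.
- move=> t; apply: cvg_set_val => /=.
  exact: (continuous_comp (clamp_continuous (x := t)) (gc (clamp t))).
- by apply: val_inj => /=; rewrite clamp_id ?lexx ?ler01.
- by apply: val_inj => /=; rewrite clamp_id ?lexx ?ler01.
- by move=> t t01; split=> //=; rewrite /preimage /mkset; have [] := gM _ (clamp_itv t).
Qed.

Lemma locally_star_prod (X Y : topologicalType) (x : X) (y : Y) :
  locally_star_in [set: X] x -> locally_star_in [set: Y] y ->
  locally_star_in [set: X * Y] (x, y).
Proof.
move=> Hx Hy Q [[A B] /= [nA nB] AB].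
have [M [nM MA Mg]] := Hx _ nA; have [K [nK KB Kg]] := Hy _ nB.
exists (M `*` K); split.
- by exists (M, K).
- by move=> p [/= /MA ? /KB ?]; exact: AB.
move=> [x1 y1] [/= Mx Ky] _.
have [g [gc g0 g1 gM]] := Mg _ Mx I; have [h [hc h0 h1 hK]] := Kg _ Ky I.
exists (fun t => (g t, h t)); split.
- by move=> t; apply: cvg_pair; [exact: gc|exact: hc].
- by rewrite g0 h0.
- by rewrite g1 h1.
- by move=> t t01; split=> //; split=> /=; [have [] := gM _ t01|have [] := hK _ t01].
Qed.

(** A star-shaped neighborhood is the union of paths through x. *)
Lemma locally_star_connected (X : topologicalType) (x : X) : locally_star_in [set: X] x ->
  forall Q, nbhs x Q -> exists M, [/\ nbhs x M, M `<=` Q & connected M].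
Proof.
move=> H Q nQ; have [M [nM MQ Mg]] := H _ nQ; exists M; split=> //.
pose I := [set g : R -> X | [/\ continuous g, g 0 = x & forall t, 0 <= t <= 1 -> M (g t)]].
have -> : M = \bigcup_(g in I) (g @` `[0, 1]%classic).
  apply/seteqP; split=> [y My|y [g [_ _ gM] [t /= t01 <-]]]; last first.
    by apply: gM; rewrite in_itv in t01.
  have [g [gc g0 g1 gM]] := Mg _ My Logic.I.
  exists g; last by exists 1 => //=; rewrite in_itv /= ler01 lexx.
  by split=> // t /gM[].
apply: bigcup_connected.
  by exists x => g [_ g0 _]; exists 0 => //=; rewrite in_itv /= lexx ler01.
move=> g [gc _ _]; apply: connected_continuous_connected.
  by apply/connected_intervalP; exact: interval_is_interval.
exact: continuous_subspaceT.
Qed.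

End LocallyStarShaped.

(** * Segments of problems *)

Section Segments.
Variable R : realType.
Local Notation C := R[i].

Definition segc (x y : C) (t : R) : C := x + t%:C * (y - x).
Definition segmx m n (M M' : 'M[C]_(m, n)) (t : R) : 'M[C]_(m, n) :=
  M + t%:C *: (M' - M).

Lemma segmxE m n (M M' : 'M[C]_(m, n)) t i j : segmx M M' t i j = segc (M i j) (M' i j) t.
Proof. by rewrite !mxE. Qed.

Lemma segmx0 m n (M M' : 'M[C]_(m, n)) : segmx M M' 0 = M.
Proof. by rewrite /segmx scale0r addr0. Qed.

Lemma segmx1 m n (M M' : 'M[C]_(m, n)) : segmx M M' 1 = M'.
Proof. by rewrite /segmx scale1r addrC subrK. Qed.

Lemma real_complex_cvg (t : R) : (fun s : R => s%:C) @ nbhs t --> (t%:C : C).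
Proof.
apply/cvgrPdist_lt => e e0; have /complex_realP[e' E] := gtr0_real e0.
have e'0 : 0 < e' by rewrite -ltcR -E.
apply: filterS (nbhsx_ballx t e' e'0) => s; rewrite -ball_normE /=.
by rewrite E -rmorphB /= normcR ltcR.
Qed.

Lemma segmx_mx_cvg m n (M M' : 'M[C]_(m, n)) t :
  mx_cvg (F := nbhs t) (segmx M M') (segmx M M' t).
Proof.
move=> i j; rewrite segmxE; under eq_fun do rewrite segmxE.
have h : (fun s : R => s%:C * (M' i j - M i j)) @ nbhs t --> t%:C * (M' i j - M i j).
  have c : (fun _ : R => M' i j - M i j) @ nbhs t --> M' i j - M i j by exact: cvg_cst.
  exact: (cvgM (@real_complex_cvg t) c).
have c : (fun _ : R => M i j) @ nbhs t --> M i j by exact: cvg_cst.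
exact: (cvgD c h).
Qed.

(** Local convexity towards the point x only, for a given notion of segment. *)
Definition seg_nbhs (X : topologicalType) (seg : X -> X -> R -> X) (x : X) :=
  forall A, nbhs x A -> exists B, [/\ nbhs x B, B `<=` A &
    forall y t, 0 <= t <= 1 -> B y -> B (seg x y t)].

(** The star-shaped core of a neighborhood: the points whose whole segment to M
    stays in it. A part of such a segment is again such a segment. *)
Lemma seg_nbhs_mx m n (M : 'M[C]_(m, n)) : seg_nbhs (@segmx m n) M.
Proof.
move=> A [P MP PA].
pose K i j := [set z : C | forall t, 0 <= t <= 1 -> P i j (segc (M i j) z t)].
exists [set M' : 'M[C]_(m, n) | forall i j, K i j (M' i j)]; split.
- exists K => // i j; have := MP i j.
  move=> /nbhs_ballP[e /= e0 eP].
  apply: filterS (nbhsx_ballx (M i j) e e0) => z; rewrite -ball_normE /= => ze t.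
  move=> /andP[t0 t1]; apply: eP; rewrite -ball_normE /=.
  rewrite /segc opprD addrA subrr add0r normrN normrM normcR (ger0_norm t0) distrC.
  by apply: le_lt_trans ze; rewrite ler_piMl// lecR.
- move=> M' KM'; apply: PA => i j; have := KM' i j 1.
  by rewrite /segc mul1r addrC subrK; apply; rewrite ler01 lexx.
- move=> M' t /andP[t0 t1] KM' i j s /andP[s0 s1]; rewrite segmxE.
  have -> : segc (M i j) (segc (M i j) (M' i j) t) s = segc (M i j) (M' i j) (s * t).
    by rewrite /segc rmorphM /=; ring.
  by apply: KM'; rewrite mulr_ge0//= mulr_ile1.
Qed.

Lemma seg_nbhs_prod (X Y : topologicalType) (sX : X -> X -> R -> X)
    (sY : Y -> Y -> R -> Y) (x : X) (y : Y) :
  seg_nbhs sX x -> seg_nbhs sY y ->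
  seg_nbhs (fun p q t => (sX p.1 q.1 t, sY p.2 q.2 t)) (x, y).
Proof.
move=> hx hy S [[A B] /= [nA nB] AB].
have [A' [nA' sA hA]] := hx _ nA; have [B' [nB' sB hB]] := hy _ nB.
exists (A' `*` B'); split.
- by exists (A', B').
- by move=> p [/= /sA ? /sB ?]; apply: AB.
- by move=> p t t01 [/= ? ?]; split=> /=; [exact: hA|exact: hB].
Qed.

Lemma segc_real (x y : C) t : x \is Num.real -> y \is Num.real -> segc x y t \is Num.real.
Proof.
move=> xr yr; rewrite /segc realD// realM ?realB//.
by apply/complex_realP; exists t.
Qed.

Lemma segc_gt0 (x y : C) t : 0 <= t <= 1 -> 0 < x -> 0 < y -> 0 < segc x y t.
Proof.
move=> /andP[t0 t1] x0 y0; have -> : segc x y t = (1 - t)%:C * x + t%:C * y.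
  by rewrite /segc rmorphB /=; ring.
have [->|t1'] := eqVneq t 1; first by rewrite subrr mul0r add0r mul1r.
apply: ltr_wpDr; first by rewrite mulr_ge0 ?(ltW y0)// lecR.
by rewrite mulr_gt0// ltcR subr_gt0 lt_neqAle t1'.
Qed.

End Segments.

Section CoeffStar.
Variables (R : realType) (N : nat).
Local Notation C := R[i].

Definition segom (om om' : coeffs R N) (t : R) : coeffs R N :=
  (segmx om.1.1 om'.1.1 t, segmx om.1.2 om'.1.2 t, segmx om.2 om'.2 t).

Lemma segom_continuous om om' : continuous (segom om om').
Proof.
have c m (M M' : 'rV[C]_m) t : segmx M M' @ nbhs t --> segmx M M' t.
  exact: ((@cvg_mx R R (nbhs t) (nbhs_filter t) _ _ _ _).1 (@segmx_mx_cvg R _ _ M M' t)).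
move=> t; have c1 := @c _ om.1.1 om'.1.1 t.
have c2 := @c _ om.1.2 om'.1.2 t; have c3 := @c _ om.2 om'.2 t.
exact: (cvg_pair_nbhs (nbhs_filter t) (cvg_pair_nbhs (nbhs_filter t) c1 c2) c3).
Qed.

Lemma seg_nbhs_om om : seg_nbhs segom om.
Proof.
case: om => -[M1 M2] M3.
exact: (seg_nbhs_prod (seg_nbhs_prod (@seg_nbhs_mx R _ _ M1) (@seg_nbhs_mx R _ _ M2))
  (@seg_nbhs_mx R _ _ M3)).
Qed.

Lemma mx_neq0_near m n (M : 'M[C]_(m, n)) : (forall i j, M i j != 0) ->
  nbhs M (fun M' => forall i j, M' i j != 0).
Proof.
move=> M0; exists (fun i j => [set z : C | z != 0]) => //= i j.
have h : 0 < `|M i j| by rewrite normr_gt0.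
apply: filterS (nbhsx_ballx (M i j) _ h) => z; rewrite -ball_normE /=.
by apply: contraTneq => ->; rewrite subr0 ltxx.
Qed.

Lemma nbhs_OmegaC om : OmegaC R N om -> nbhs om (OmegaC R N).
Proof.
move=> [hf hw].
have near_f : nbhs om.1.1 (fun M => forall i j, M i j != 0).
  by apply: mx_neq0_near => i j; rewrite ord1.
have nw : nbhs om.2 (fun M => forall i j, M i j != 0).
  by apply: mx_neq0_near => i j; rewrite ord1.
exists ([set M : 'rV[C]_N.+1 | forall i j, M i j != 0] `*` [set: 'rV[C]_N],
        [set M : 'rV[C]_N | forall i j, M i j != 0]) => /=.
  split; last exact: nw.
  exists ([set M : 'rV[C]_N.+1 | forall i j, M i j != 0], [set: 'rV[C]_N]) => //=.
  by split; [exact: near_f|exact: filterT].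
by move=> p [/= [h1 _] h2]; split=> i; [exact: h1|exact: h2].
Qed.

(** OmegaC is open, so only the conditions that define A inside it must be
    checked along segments. *)
Lemma locally_star_coeffs (A : set (coeffs R N)) om : OmegaC R N om ->
  (forall om', A om' -> forall t, 0 <= t <= 1 -> OmegaC R N (segom om om' t) ->
    A (segom om om' t)) ->
  locally_star_in R A om.
Proof.
move=> hom hA Q nQ.
have : nbhs om (Q `&` OmegaC R N) by apply: filterI => //; exact: nbhs_OmegaC.
case/seg_nbhs_om=> B [nB BQ Bseg].
exists B; split=> // [om' /BQ[]//|om' Bom' Aom'].
exists (segom om om'); split.
- exact: segom_continuous.
- by rewrite /segom !segmx0; case: om {hom hA nQ nB BQ Bseg} Bom' => -[].
- by rewrite /segom !segmx1; case: om' {Bom' Aom'} => -[].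
move=> t t01; have Bt := Bseg _ _ t01 Bom'.
by split=> //; apply: hA => //; have [] := BQ _ Bt.
Qed.

Lemma locally_star_OmegaC (om : OmegaC R N) : locally_star_in R [set: OmegaC R N] om.
Proof. by apply: locally_star_sub; apply: locally_star_coeffs => //; exact: set_valP. Qed.

Lemma locally_star_OmegaRpos (om : OmegaRpos R N) : locally_star_in R [set: OmegaRpos R N] om.
Proof.
apply: locally_star_sub; have [hom f1 q1 w1] := set_valP om.
apply: locally_star_coeffs => // om' [hom' f2 q2 w2] t t01 ht; split=> // i /=.
- by rewrite segmxE segc_real.
- by rewrite segmxE segc_real.
- by rewrite segmxE segc_gt0.
Qed.

End CoeffStar.

Section BoundaryStar.
Variable R : realType.
Local Notation C := R[i].
Implicit Types P : 'M[C]_2 * 'M[C]_2.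

Definition segp P P' t := (segmx P.1 P'.1 t, segmx P.2 P'.2 t).

Lemma segp_continuous P P' : continuous (segp P P').
Proof.
move=> t; apply: (@cvg_pairP _ _ _ (nbhs_filter t)); exact: segmx_mx_cvg.
Qed.

Lemma seg_nbhs_p P : seg_nbhs segp P.
Proof.
case: P => A B; exact: (seg_nbhs_prod (@seg_nbhs_mx R _ _ A) (@seg_nbhs_mx R _ _ B)).
Qed.

Lemma gram_segp P0 P1 t : gram P1 P0 = gram P0 P0 -> gram (segp P0 P1 t) P0 = gram P0 P0.
Proof.
move=> h.
have -> : gram (segp P0 P1 t) P0 = gram P0 P0 + t%:C *: (gram P1 P0 - gram P0 P0).
  rewrite /gram /segp /segmx /= !mulmxDl -!scalemxAl !mulmxBl.
  rewrite addrACA -scalerDr; congr (_ + _ *: _).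
  by rewrite opprD addrACA.
by rewrite h subrr scaler0 addr0.
Qed.

(** On a line whose base point and direction are both isotropic, a sesquilinear
    form is linear in the real parameter. *)
Lemma form_line n (J : 'M[C]_n) m (W V : 'M[C]_(m, n)) :
  W *m J *m W^t* = 0 -> V *m J *m V^t* = 0 -> forall s : R,
  (W + s%:C *: V) *m J *m (W + s%:C *: V)^t* =
    s%:C *: (W *m J *m V^t* + V *m J *m W^t*).
Proof.
move=> W0 V0 s; have -> : (W + s%:C *: V)^t* = W^t* + s%:C *: V^t*.
  apply/matrixP => i j; rewrite !mxE rmorphD rmorphM; congr (_ + _ * _).
  by apply: conj_Creal; apply/complex_realP; exists s.
rewrite !mulmxDl !mulmxDr -!scalemxAr -!scalemxAl W0 V0 !scaler0 add0r addr0.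
by rewrite scalerDr.
Qed.

(** The direction V = W1 - W0 is orthogonal to W0 by the normalization of P1,
    hence isotropic. So by [form_line] the form at time t is t times its value
    at time 1, which is 0. *)
Lemma sa_segp P0 P1 t : bc_pair R P0 -> gram P1 P0 = gram P0 P0 ->
  sa_pair P0.1 P0.2 -> sa_pair P1.1 P1.2 ->
  sa_pair (segp P0 P1 t).1 (segp P0 P1 t).2.
Proof.
move=> /gram_unit u0 g10 /sa_pairE s0 /sa_pairE s1; apply/sa_pairE.
rewrite !gramE in u0 g10.
set W0 := row_mx P0.1 P0.2 in u0 g10 s0; set W1 := row_mx P1.1 P1.2 in g10 s1.
pose V := W1 - W0.
have VW : V *m W0^t* = 0 by rewrite mulmxBl g10 subrr.
have VJV := ortho_isotropic (@Jmx_adj R) (@Jmx_sqr R) u0 s0 VW.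
have -> : row_mx (segp P0 P1 t).1 (segp P0 P1 t).2 = W0 + t%:C *: V.
  by rewrite /segp /segmx /V opp_row_mx add_row_mx scale_row_mx add_row_mx.
have expand := form_line s0 VJV.
have : (W0 + 1%:C *: V) *m Jmx R *m (W0 + 1%:C *: V)^t* = 0.
  by rewrite scale1r addrC subrK.
by rewrite !expand scale1r => ->; rewrite scaler0.
Qed.

(** The classes near that of P0 are those of their normal representatives,
    which form an affine subspace through P0. The segments in it project to the
    paths. The hypothesis says that A contains the segments that end in A. *)
Lemma locally_star_bc (A : set (bc_space R)) (P0 : bc_pair R) :
  (forall P1 : bc_pair R, A (\pi_(bc_space R) P1) ->
    gram (set_val P1) (set_val P0) = gram (set_val P0) (set_val P0) ->
    forall P2 : bc_pair R, (exists t, set_val P2 = segp (set_val P0) (set_val P1) t) ->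
    A (\pi_(bc_space R) P2)) ->
  locally_star_in R A (\pi_(bc_space R) P0).
Proof.
move=> hA Q nQ; set W0 := set_val P0 in hA *.
have bW0 : bc_pair R W0 := set_valP P0.
have uW0 := gram_unit bW0.
have [B [nB Bseg BQ]] : exists B : set ('M[C]_2 * 'M[C]_2), [/\ nbhs W0 B,
    forall P t, 0 <= t <= 1 -> B P -> B (segp W0 P t)
    & forall P1 : bc_pair R, B (set_val P1) -> Q (\pi_(bc_space R) P1)].
  have : nbhs P0 (\pi_(bc_space R) @^-1` Q).
    exact: (@pi_continuous _ {eq_quot (@bc_equiv R)} P0 Q nQ).
  case=> U [[V oV VU] UP0 UQ].
  have : nbhs W0 V by apply: open_nbhs_nbhs; split=> //; move: UP0; rewrite -VU.
  case/seg_nbhs_p=> B [nB BV Bseg]; exists B; split=> // P1 /BV VP1.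
  by apply: UQ; rewrite -VU.
have bc_of P : gram P W0 = gram W0 W0 -> bc_pair R P.
  by move=> h; apply: (@gram_bc_pair _ _ W0); rewrite h.
have gauge1 P : gram P W0 = gram W0 W0 -> gauge W0 P = 1%:M.
  by move=> h; rewrite /gauge h mulmxV.
have gauge_fix1 P : gram P W0 = gram W0 W0 -> gauge_fix W0 P = P.
  by move=> h; rewrite /gauge_fix gauge1// /lmul_pair invmx1 !mul1mx -surjective_pairing.
pose M := [set b : bc_space R | gauge W0 (set_val (repr b)) \in unitmx /\ B (normal_rep W0 b)].
have normalP b : gauge W0 (set_val (repr b)) \in unitmx ->
    exists P1 : bc_pair R, [/\ \pi_(bc_space R) P1 = b, set_val P1 = normal_rep W0 b
      & gram (normal_rep W0 b) W0 = gram W0 W0].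
  move=> u; have g : gram (normal_rep W0 b) W0 = gram W0 W0.
    rewrite /normal_rep /gauge_fix gram_lmul; apply: (can_inj (mulKmx u)).
    by rewrite mulKVmx// /gauge mulmxKV.
  exists (to_bc_pair (bc_of _ g)); split=> //.
  rewrite -[RHS]reprK; apply/eqP/pi_eqP; exists (gauge W0 (set_val (repr b))) => //.
  by rewrite -[LHS](gauge_fixK u).
exists M; split.
- apply: filterI; first exact: gauge_repr_unit_near.
  exact: (@normal_rep_cvg_pair R P0 B nB).
- move=> b [u Bb]; have [P1 [Eb E _]] := normalP b u; rewrite -E in Bb.
  by rewrite -Eb; exact: (BQ P1 Bb).
move=> b [u Bb] Ab; have [P1 [Eb E g]] := normalP b u; rewrite -E in g Bb.
have gt t := gram_segp t g.
pose h t := to_bc_pair (bc_of _ (gt t)).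
exists (fun t => \pi_(bc_space R) (h t)); split.
- move=> t; have hc : h @ nbhs t --> h t.
    apply: (cvg_set_val (nbhs_filter t)).
    exact: segp_continuous.
  exact: (cvg_comp _ _ hc (@pi_continuous _ {eq_quot (@bc_equiv R)} (h t))).
- congr (\pi_(bc_space R) _); apply: val_inj.
  by rewrite /= /segp !segmx0 -surjective_pairing.
- rewrite -Eb; congr (\pi_(bc_space R) _); apply: val_inj.
  by rewrite /= /segp !segmx1 -surjective_pairing.
move=> t t01.
split; last by apply: (hA P1); [rewrite Eb|exact: g|exists t].
have uu : gauge W0 (segp W0 (set_val P1) t) \in unitmx by rewrite gauge1// unitmx1.
split; first by rewrite gauge_repr.
rewrite normal_rep_pi// gauge_fix1; [exact: Bseg|exact: gt].
Qed.

Lemma locally_star_bc_space (b : bc_space R) : locally_star_in R [set: bc_space R] b.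
Proof. by rewrite -(reprK b); exact: locally_star_bc. Qed.

Lemma locally_star_BC (b : BC R) : locally_star_in R [set: BC R] b.
Proof.
apply: locally_star_sub; rewrite -(reprK (set_val b)).
apply: locally_star_bc => P1 /BC_pi s1 g P2 [t E].
apply/BC_pi; rewrite E; apply: sa_segp => //; first exact: set_valP.
by apply/BC_pi; rewrite reprK; exact: set_valP.
Qed.

End BoundaryStar.

(** * Continuous eigenvalues *)

Local Close Scope quotient_scope.
Local Close Scope sesquilinear_scope.

Lemma loc_poly_cvg_comp (R : realType) (S T : topologicalType) (f : S -> T)
    (G : T -> {poly R[i]}) (s : S) :
  f @ nbhs s --> f s -> loc_poly_cvg G (f s) -> loc_poly_cvg (G \o f) s.
Proof.
move=> fs [H [[Hn Hc] GH]]; exists (H \o f); split; last exact: (fs _ GH).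
split=> [|i]; last exact: (cvg_comp _ _ fs (Hc i)).
by have [n [h1 h2]] := Hn; exists n; split=> // t; exact: h1.
Qed.

Lemma simple_eigenvalue_continuation (R : realType) (N : nat)
    (om : OmegaC R N) (bc : bc_space R) (lam : R[i]) :
  simple_eigenvalue (set_val om) bc lam ->
  exists (M : set (OmegaC R N * bc_space R))
         (Lambda : OmegaC R N * bc_space R -> R[i]),
    [/\ nbhs (om, bc) M /\ connected M,
        {within M, continuous Lambda},
        Lambda (om, bc) = lam
      & forall p, M p -> simple_eigenvalue (set_val p.1) p.2 (Lambda p)].
Proof.
move=> [_ m1].
pose f (p : OmegaC R N * bc_space R) := (set_val p.1, p.2).
have G_loc p : loc_poly_cvg (@Gamma_of R N \o f) p.
  apply: loc_poly_cvg_comp; last exact: Gamma_loc_poly_cvg.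
  case: p => om1 b1.
  have c1 : (fun p : OmegaC R N * bc_space R => set_val p.1) @ nbhs (om1, b1) --> set_val om1.
    exact: (cvg_comp _ _ (@cvg_fst _ _ (nbhs om1) (nbhs b1) (nbhs_filter _))
      (@set_val_cvg _ _ om1)).
  have c2 : (fun p : OmegaC R N * bc_space R => p.2) @ nbhs (om1, b1) --> b1.
    exact: (@cvg_snd _ _ (nbhs om1) (nbhs b1) (nbhs_filter _)).
  exact: (cvg_pair_nbhs (nbhs_filter (om1, b1)) c1 c2).
have [Q [L [nQ L0 Lc Lm]]] := simple_root_continuation G_loc (t0 := (om, bc)) m1.
have [M [nM MQ Mc]] := locally_star_connected
  (locally_star_prod (@locally_star_OmegaC R N om) (@locally_star_bc_space R bc)) nQ.
exists M, L; split=> //; first exact: continuous_subspaceW Lc.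
move=> p /MQ /Lm Lp; split=> //.
apply: root_Gamma_eigenvalue; first exact: set_valP.
by apply: mup_root; rewrite [X in (0 < X)%N]Lp.
Qed.

Lemma double_eigenvalue_continuation (R : realType) (N : nat) (hN : (2 <= N)%N)
    (om : OmegaRpos R N) (bc : BC R) (lam : R[i]) (eps : R) :
  multiplicity (set_val om) (set_val bc) lam = 2%N -> 0 < eps ->
  exists (F : set (OmegaRpos R N * BC R))
         (Lambda1 Lambda2 : OmegaRpos R N * BC R -> R),
    [/\ nbhs (om, bc) F /\ connected F,
        {within F, continuous Lambda1} /\ {within F, continuous Lambda2},
        (Lambda1 (om, bc))%:C = lam /\ (Lambda2 (om, bc))%:C = lam,
        forall p, F p ->
          [/\ lam - eps%:C < (Lambda1 p)%:C, Lambda1 p <= Lambda2 p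
            & (Lambda2 p)%:C < lam + eps%:C]
      & forall p, F p ->
          is_eigenvalue (set_val p.1) (set_val p.2) (Lambda1 p)%:C /\
          is_eigenvalue (set_val p.1) (set_val p.2) (Lambda2 p)%:C].
Proof.
move=> m2 e0.
pose f (p : OmegaRpos R N * BC R) := (set_val p.1, set_val p.2).
have G_loc p : loc_poly_cvg (@Gamma_of R N \o f) p.
  apply: loc_poly_cvg_comp; last exact: Gamma_loc_poly_cvg.
  case: p => om1 b1.
  have c1 : (fun p : OmegaRpos R N * BC R => set_val p.1) @ nbhs (om1, b1) --> set_val om1.
    exact: (cvg_comp _ _ (@cvg_fst _ _ (nbhs om1) (nbhs b1) (nbhs_filter _))
      (@set_val_cvg _ _ om1)).
  have c2 : (fun p : OmegaRpos R N * BC R => set_val p.2) @ nbhs (om1, b1) --> set_val b1.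
    exact: (cvg_comp _ _ (@cvg_snd _ _ (nbhs om1) (nbhs b1) (nbhs_filter _))
      (@set_val_cvg _ _ b1)).
  exact: (cvg_pair_nbhs (nbhs_filter (om1, b1)) c1 c2).
have G_eig p z : root ((@Gamma_of R N \o f) p) z ->
    is_eigenvalue (set_val p.1) (set_val p.2) z.
  by apply: root_Gamma_eigenvalue; have [] := set_valP p.1.
have G_real p z : root ((@Gamma_of R N \o f) p) z -> z \is Num.real.
  move=> /G_eig; apply: selfadjoint_eigenvalue_real => //.
  - exact: set_valP.
  - rewrite /bcA /bcB -surjective_pairing; exact: set_valP.
  - exact: set_valP p.2.
have e0C : (0 : R[i]) < eps%:C by rewrite ltcR.
have [Q [L1 [L2 [nQ [L10 L20] [L1c L2c] Lbd Lr]]]] :=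
  double_root_continuation G_loc G_real (t0 := (om, bc)) e0C m2.
have [M [nM MQ Mc]] := locally_star_connected
  (locally_star_prod (@locally_star_OmegaRpos R N om) (@locally_star_BC R bc)) nQ.
exists M, L1, L2; split.
- by split.
- by split; [exact: continuous_subspaceW L1c|exact: continuous_subspaceW L2c].
- by split.
- move=> p /MQ /Lbd[]; rewrite -L10 -!rmorphB -rmorphD !normcR !ltcR !ltr_norml.
  move: (L1 (om, bc)) (L1 p) (L2 p) => l x y /andP[h1 h2] h3 /andP[h4 h5].
  by split=> //; lra.
- by move=> p /MQ /Lr[/G_eig h1 /G_eig h2]; split.
Qed.

Theorem theorem3p5 (R : realType) (N : nat) (hN : (2 <= N)%N) :
  (forall (om : OmegaC R N) (bc : bc_space R) (lam : R[i]),
     simple_eigenvalue (set_val om) bc lam ->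
     exists (M : set (OmegaC R N * bc_space R))
            (Lambda : OmegaC R N * bc_space R -> R[i]),
       [/\ nbhs (om, bc) M /\ connected M,
           {within M, continuous Lambda},
           Lambda (om, bc) = lam
         & forall p, M p -> simple_eigenvalue (set_val p.1) p.2 (Lambda p)])
  /\
  (forall (om : OmegaRpos R N) (bc : BC R) (lam : R[i]),
     is_eigenvalue (set_val om) (set_val bc) lam ->
     multiplicity (set_val om) (set_val bc) lam = 2%N ->
     forall eps : R, 0 < eps ->
     (forall mu : R[i], is_eigenvalue (set_val om) (set_val bc) mu ->
        lam - eps%:C <= mu <= lam + eps%:C -> mu = lam) ->
     exists (F : set (OmegaRpos R N * BC R))
            (Lambda1 Lambda2 : OmegaRpos R N * BC R -> R),
       [/\ nbhs (om, bc) F /\ connected F,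
           {within F, continuous Lambda1} /\ {within F, continuous Lambda2},
           (Lambda1 (om, bc))%:C = lam /\ (Lambda2 (om, bc))%:C = lam,
           forall p, F p ->
             [/\ lam - eps%:C < (Lambda1 p)%:C, Lambda1 p <= Lambda2 p
               & (Lambda2 p)%:C < lam + eps%:C]
         & forall p, F p ->
             is_eigenvalue (set_val p.1) (set_val p.2) (Lambda1 p)%:C /\
             is_eigenvalue (set_val p.1) (set_val p.2) (Lambda2 p)%:C]).
Proof.
split=> [om bc lam|om bc lam _ m2 eps e0 _]; first exact: simple_eigenvalue_continuation.
exact: double_eigenvalue_continuation.
Qed.
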